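(* The type-$AA$ bimodule ${}_{\mathcal K}[\mathcal{T}r]_{\mathcal K^!}$ and the type-$DD$ bimodule ${}^{\mathcal K^!}[\mathcal{C}o]^{\mathcal K}$ satisfy $${}_{\mathcal K}[\mathcal{T}r]_{\mathcal K^!}\boxtimes{}^{\mathcal K^!}[\mathcal{C}o]^{\mathcal K}={}_{\mathcal K}\mathbb I^{\mathcal K}\qquad\text{and}\qquad {}^{\mathcal K^!}[\mathcal{C}o]^{\mathcal K}\boxtimes{}_{\mathcal K}[\mathcal{T}r]_{\mathcal K^!}={}^{\mathcal K^!}\mathbb I_{\mathcal K^!}$$ (equality of $DA$-bimodules, where all underlying spaces are identified with $\mathbf I$).
   Context: **The algebra $\mathcal K$.** $\mathbb F=\mathbb Z/2$, and $\mathbf I=\mathbf I_0\oplus\mathbf I_1$ with $\mathbf I_\varepsilon\cong\mathbb F$ (units $i_0,i_1$). Tensor products are over $\mathbf I$. $\mathcal K$ is the associative $\mathbf I$-algebra with $\mathbf I_0\mathcal K\mathbf I_0=R_0=\mathbb F[W,Z]$, $\mathbf I_1\mathcal K\mathbf I_1=R_1=\mathbb F[U,T,T^{-1}]$, $\mathbf I_0\mathcal K\mathbf I_1=0$, and $\mathbf I_1\mathcal K\mathbf I_0=R_1\sigma\oplus R_1\tau$ (free left $R_1$-module), with relations $\sigma W=UT^{-1}\sigma$, $\sigma Z=T\sigma$, $\tau W=T^{-1}\tau$, $\tau Z=UT\tau$. Write also $U=WZ\in R_0$. **The curved $dg$-algebra $\mathcal K^!$** over $\mathbf I$: $\mathbf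 I_0\mathcal K^!\mathbf I_0=\mathbb F\langle w,z,\theta\rangle/(w^2,z^2,\theta^2,[\theta,w],[\theta,z])$; $\mathbf I_1\mathcal K^!\mathbf I_1=\mathbb F\langle\varphi_+,\varphi_-,\theta\rangle/(\varphi_\pm^2,\theta^2,[\theta,\varphi_\pm])$; $\mathbf I_1\mathcal K^!\mathbf I_0=0$; $\mathbf I_0\mathcal K^!\mathbf I_1$ is generated as a bimodule by $s,t$ with $ws=zt=s\varphi_-=t\varphi_+=0$, $\theta s=s\theta$, $\theta t=t\theta$, $zs=s\varphi_+$, $wt=t\varphi_-$ (so it has $\mathbb F$-basis $s,zs,\theta s,\theta zs,t,wt,\theta t,\theta wt$). The differential $\mu_1$ satisfies the Leibniz rule, $\mu_1(\theta)=wz+zw$ for $\theta$ in idempotent $0$, $\mu_1(\theta)=0$ for $\theta$ in idempotent $1$, and vanishes on $w,z,s,t,\varphi_\pm$. The curvature is $\mu_0=\varphi_+\varphi_-+\varphi_-\varphi_+$. No higher operations. **Cotrace.** ${}^{\mathcal K^!}[\mathcal{C}o]^{\mathcal K}$ has underlying $(\mathbf I,\mathbf I)$-bimodule $\mathbf I$ and $\delta^{1,1}(i_0)=w\otimes i_0\otimes W+z\otimes i_0\otimes Z+\theta\otimes i_0\otimes U+s\otimes i_1\otimes\sigma+t\otimes i_1\otimes\tau$, $\delta^{1,1}(i_1)=\varphi_+\otimes i_1\otimes T+\varphi_-\otimes i_1\otimes T^{-1}+\theta\otimes i_1\otimes U$. Its iterates $\delta^{k,k}$ have terms $b_1\otimes\cdots\otimes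 b_k\otimes x'\otimes a_k\otimes\cdots\otimes a_1$, with $(b_1,a_1)$ produced first. **The bimodule $\mathscr L$.** ${}_{\mathcal K}\mathscr L_{\mathcal K^!}$ is the type-$AA$ bimodule with underlying space $\mathcal K\otimes_{\mathbf I}\overline{\mathcal K}{}^!$, where $\overline{\mathcal K}{}^!$ is the span of the dual basis elements $y^*$ of monomials $y\in\mathcal K^!$ (if $y\in\mathbf I_\delta\mathcal K^!\mathbf I_\varepsilon$ then $y^*\in \mathbf I_\varepsilon\overline{\mathcal K}{}^!\mathbf I_\delta$). Write $a|y^*$ for $a\otimes y^*$. Set $(y^*\cdot b)(x)=y^*(bx)$, $(c\cdot y^* )(x)=y^*(xc)$. The operations are $m_{1|1|0}(a',a|y^* )=a'a|y^*$, $m_{0|1|1}(a|y^*,b)=a|(y^*\cdot b)$, $m_{0|1|0}(a|y^* )=a|(y^*\circ\mu_1)+\sum_{(c,e)}ae|(c\cdot y^* )$, the sum over $(c,e)\in\{(w,W),(z,Z),(s,\sigma),(t,\tau),(\varphi_+,T),(\varphi_-,T^{-1})\}$ and $(\theta,U)$ in each idempotent; all other operations vanish. **Maps $d,H,\Pi,I$.** Define $\mathbb F$-linear maps $d,H:\mathscr L\to\mathscr L$, zero except as listed. Below $\epsilon\in\{0,1\}$. (i) Idempotent $(0,0)$, $y$ an alternating word in $w,z$ (possibly empty, i.e. $1$). $R_0$ has $\mathbb F$-basis consisting of $U^k$, $U^kW^i$, $U^kZ^i$ ($k\ge0,i>0$). Let $\pi_{W\ge0}$ (resp. $\pi_{W>0}$)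 be projection to the span of $U^kW^i$ with $i\ge 0$ (resp. $i>0$), similarly for $Z$, and let $\pi_{0}$ (resp. $\pi_{0}^{>}$) be projection to the span of $U^k$, $k\ge0$ (resp. $k>0$). If $yw\ne0$: $d$ has component $a|(yw\theta^\epsilon)^*\mapsto W\pi_{W\ge0}(a)|(y\theta^\epsilon)^*$ and $H$ has component $a|(y\theta^\epsilon)^*\mapsto W^{-1}\pi_{W>0}(a)|(yw\theta^\epsilon)^*$; the same with $(w,W)$ replaced by $(z,Z)$ if $yz\neq 0$. Also $d$ has component $a|\theta^*\mapsto U\pi_0(a)|1^*$ and $H$ has component $a|1^*\mapsto U^{-1}\pi_0^{>}(a)|\theta^*$. (ii) Idempotent $(1,0)$, $a\in R_1$: for $y\in\{1,z\}$, $d:a|(ys\theta^\epsilon)^*\mapsto a\sigma|(y\theta^\epsilon)^*$ and $H:a\sigma|(y\theta^\epsilon)^*\mapsto a|(ys\theta^\epsilon)^*$; for each alternating word $y$ ending in $w$, $d:a\sigma|(yz\theta^\epsilon)^*\mapsto aT\sigma|(y\theta^\epsilon)^*$ and $H:a\sigma|(y\theta^\epsilon)^*\mapsto aT^{-1}\sigma|(yz\theta^\epsilon)^*$. Symmetrically, with $(\sigma,s,w,z,T)$ replaced by $(\tau,t,z,w,T^{-1})$. (iii) Idempotent $(1,1)$, $y$ an alternating word in $\varphi_\pm$ (possibly $1$): if $y\varphi_+\ne0$, $d$ has component $a|(y\varphi_+\theta^\epsilon)^*\mapsto T\pi_{T\ge0}(a)|(y\theta^\epsilon)^*$ and $H$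 has component $a|(y\theta^\epsilon)^*\mapsto T^{-1}\pi_{T>0}(a)|(y\varphi_+\theta^\epsilon)^*$; if $y\varphi_-\neq0$, $d$ has component $a|(y\varphi_-\theta^\epsilon)^*\mapsto T^{-1}\pi_{T\le0}(a)|(y\theta^\epsilon)^*$ and $H$ has component $a|(y\theta^\epsilon)^*\mapsto T\pi_{T<0}(a)|(y\varphi_-\theta^\epsilon)^*$, where $\pi_{T\ge 0}$ etc. project to monomials $U^iT^j$ with $j\ge0$ etc. Also $d$ has components $a|(y\theta)^*\mapsto Ua|y^*$ for all $y$, and $H$ has component $a|1^*\mapsto U^{-1}\pi(a)|\theta^*$, $\pi$ the projection to the span of $U^i$, $i>0$. $\Pi:\mathscr L\to\mathbf I$ sends $1|1^*$ (in $R_\varepsilon|1^*$) to $i_\varepsilon$ and other monomials to $0$; $I:\mathbf I\to\mathscr L$ sends $i_\varepsilon$ to $1|1^*\in R_\varepsilon|1^*$. **Trace.** ${}_{\mathcal K}[\mathcal{T}r]_{\mathcal K^!}$ has underlying bimodule $\mathbf I$. Put $\alpha_{0|1|0}=m_{0|1|0}+d$, $\alpha_{1|1|0}=m_{1|1|0}$, $\alpha_{0|1|1}=m_{0|1|1}$. Then $m_{k|1|n}(a_k,\dots,a_1,x,b_1,\dots,b_n)$ is the sum of all compositions $\Pi\circ\alpha\circ H\circ\alpha\circ\cdots\circ H\circ\alpha\circ I$ applied to $x$ (at least one $\alpha$), where each $\alpha$ is $\alpha_{0|1|0}$, $\alpha_{1|1|0}(a_i,-)$ or $\alpha_{0|1|1}(-,b_j)$,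 each $a_i$ and each $b_j$ is used exactly once, with the $a_i$ applied in the order $a_1,a_2,\dots$ and the $b_j$ in the order $b_1,b_2,\dots$ (arbitrarily interleaved), and any number of $\alpha_{0|1|0}$'s. **Box tensor products.** On $[\mathcal{T}r]\boxtimes[\mathcal{C}o]$: $\delta^1_{n+1}(a_n,\dots,a_1,x\otimes y)=\sum_{k\ge0}\sum m_{n|1|k}(a_n,\dots,a_1,x,b_1,\dots,b_k)\otimes y'\otimes c_k\cdots c_1$, where $\delta^{k,k}(y)=\sum b_1\otimes\cdots\otimes b_k\otimes y'\otimes c_k\otimes\cdots\otimes c_1$. On $[\mathcal{C}o]\boxtimes[\mathcal{T}r]$: $\delta^1_{n+1}(y\otimes x,b_1,\dots,b_n)=\sum_{k\ge0}\sum b'_1\cdots b'_k\otimes y'\otimes m_{k|1|n}(c_k,\dots,c_1,x,b_1,\dots,b_n)$, where $\delta^{k,k}(y)=\sum b'_1\otimes\cdots\otimes b_k'\otimes y'\otimes c_k\otimes\cdots\otimes c_1$. (Empty products are $1$.) **Identity bimodules.** ${}_{\mathcal K}\mathbb I^{\mathcal K}$ and ${}^{\mathcal K^!}\mathbb I_{\mathcal K^!}$ have underlying space $\mathbf I$, $\delta_2^1(a,1)=1\otimes a$, resp. $\delta_2^1(1,b)=b\otimes1$, and all other $\delta^1_j=0$. *)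

(* Defs.v *)
From HB Require Import structures.
From mathcomp Require Import all_boot all_order all_algebra finmap.
From mathcomp.multinomials Require Import monalg.
From mathcomp.classical Require Import classical_sets cardinality fsbigop.

Set Implicit Arguments.
Unset Strict Implicit.
Unset Printing Implicit Defensive.

Import GRing.Theory.
Local Open Scope ring_scope.

(* [idem] indexes the idempotents: [false] is i_0 and [true] is i_1.
   An (I,I)-bimodule is presented by an F-basis of homogeneous elements:
   [b] spans a line in I_(lidem b) M I_(ridem b).                             *)
Definition idem : Type := bool.

HB.mixin Record hasIdems (B : Type) := { lidem : B -> idem; ridem : B -> idem }.

#[short(type="ibasisType")]
HB.structure Definition IBasis := { B of Choice B & hasIdems B }.

Definition span (B : ibasisType) : Type := {malg 'F_2[B]}.
HB.instance Definition _ (B : ibasisType) := Choice.on (span B).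

(* The module structure of [span B] is that of [{malg 'F_2[B]}]; its operations
   are locked because unfolding them makes unification diverge in practice.   *)
HB.lock Definition span0 (B : ibasisType) : span B := 0 : {malg 'F_2[B]}.
HB.lock Definition spanD (B : ibasisType) (u v : span B) : span B :=
  (u : {malg 'F_2[B]}) + v.
HB.lock Definition spanN (B : ibasisType) (u : span B) : span B :=
  - (u : {malg 'F_2[B]}).
HB.lock Definition spanZ (B : ibasisType) (c : 'F_2) (u : span B) : span B :=
  c *: (u : {malg 'F_2[B]}).
HB.lock Definition mon (B : ibasisType) (b : B) : span B := << b >>.

Section SpanModule.
Variable B : ibasisType.
Implicit Types u v w : span B.

Fact spanDA : associative (@spanD B).
Proof. by move=> u v w; rewrite unlock addrA. Qed.
Fact spanDC : commutative (@spanD B).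
Proof. by move=> u v; rewrite unlock addrC. Qed.
Fact span0D : left_id (span0 B) (@spanD B).
Proof. by move=> u; rewrite !unlock add0r. Qed.
Fact spanND : left_inverse (span0 B) (@spanN B) (@spanD B).
Proof. by move=> u; rewrite !unlock addNr. Qed.

HB.instance Definition _ :=
  GRing.isZmodule.Build (span B) spanDA spanDC span0D spanND.

Fact spanZA c d u : spanZ c (spanZ d u) = spanZ (c * d) u.
Proof. by rewrite unlock scalerA. Qed.
Fact span1Z : left_id 1 (@spanZ B).
Proof. by move=> u; rewrite unlock scale1r. Qed.
Fact spanZDr : right_distributive (@spanZ B) +%R.
Proof. by move=> c u v; rewrite /GRing.add /= !unlock scalerDr. Qed.
Fact spanZDl u : {morph (fun c => spanZ c u) : c d / c + d}.
Proof. by move=> c d; rewrite {2}/GRing.add /= !unlock scalerDl. Qed.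

HB.instance Definition _ :=
  GRing.Zmodule_isLmodule.Build 'F_2 (span B) spanZA span1Z spanZDr spanZDl.

Lemma coef0 b : (0 : span B)@_b = 0.
Proof. by rewrite /GRing.zero /= unlock mcoeff0. Qed.
Lemma coefD u v b : (u + v)@_b = u@_b + v@_b.
Proof. by rewrite {1}/GRing.add /= unlock mcoeffD. Qed.
Lemma coefZ c u b : (c *: u)@_b = c * u@_b.
Proof. by rewrite /GRing.scale /= unlock mcoeffZ. Qed.
Lemma coef_mon (a b : B) : (mon a)@_b = (a == b)%:R.
Proof. by rewrite unlock mcoeffU. Qed.
Lemma coef_sum (I : Type) (r : seq I) (P : pred I) (F : I -> span B) b :
  (\sum_(i <- r | P i) F i)@_b = \sum_(i <- r | P i) (F i)@_b.
Proof.
by elim/big_rec2: _ => [|i x y _ <-]; [exact: coef0 | exact: coefD].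
Qed.
Lemma spanP u v : (forall b, u@_b = v@_b) -> u = v.
Proof. by move=> h; apply/malgP. Qed.

Lemma msupp_spanD u v : (msupp (u + v) `<=` msupp u `|` msupp v)%fset.
Proof.
apply/fsubsetP => b; apply: contraLR; rewrite in_fsetU negb_or -!mcoeff_eq0 coefD.
by case/andP=> /eqP -> /eqP ->; rewrite addr0.
Qed.
Lemma msupp_spanZ c u : (msupp (c *: u) `<=` msupp u)%fset.
Proof.
apply/fsubsetP => b; rewrite -!mcoeff_neq0 coefZ.
by apply: contraTneq => ->; rewrite mulr0 negbK.
Qed.
Lemma msupp_mon (b : B) : (msupp (mon b) `<=` [fset b])%fset.
Proof.
apply/fsubsetP => a; rewrite -mcoeff_neq0 coef_mon inE [a == b]eq_sym.
by case: (b == a).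
Qed.
Lemma spanE u : u = \sum_(b <- msupp u) u@_b *: mon b.
Proof.
apply: spanP => b; rewrite coef_sum.
case: (msuppP u b) => [bu|nbu].
  rewrite (big_fsetD1 b) //= coefZ coef_mon eqxx mulr1 big1_fset ?addr0 //.
  by move=> a; rewrite !inE => /andP[ab _] _; rewrite coefZ coef_mon (negPf ab) mulr0.
rewrite big1_fset // => a au _; rewrite coefZ coef_mon.
by case: eqP => [e|_]; rewrite ?mulr0 //; move: nbu; rewrite -e au.
Qed.

End SpanModule.

Definition omon (B : ibasisType) (o : option B) : span B :=
  if o is Some b then mon b else 0.

(* The F-linear extension of a map defined on the basis.                      *)
Definition lext (B : ibasisType) (V : lmodType 'F_2) (f : B -> V) (u : span B)
  : V := \sum_(b <- msupp u) u@_b *: f b.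

Section Lext.
Variables (B : ibasisType) (V : lmodType 'F_2).
Implicit Types (f : B -> V) (u v : span B).

Lemma lextw f u (D : {fset B}) : (msupp u `<=` D)%fset ->
  lext f u = \sum_(b <- D) u@_b *: f b.
Proof.
move=> le; rewrite /lext; apply: (big_fset_incl _ le) => k _ /mcoeff_outdom ->.
by rewrite scale0r.
Qed.

Lemma lextD f u v : lext f (u + v) = lext f u + lext f v.
Proof.
pose D := (msupp u `|` msupp v)%fset.
rewrite (@lextw f (u + v) D) ?msupp_spanD // (@lextw f u D) ?fsubsetUl //.
rewrite (@lextw f v D) ?fsubsetUr // -big_split /=.
by apply: eq_bigr => b _; rewrite -scalerDl coefD.
Qed.

Lemma lextZ f c u : lext f (c *: u) = c *: lext f u.
Proof.
rewrite (@lextw f (c *: u) (msupp u)) ?msupp_spanZ // /lext scaler_sumr.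
by apply: eq_bigr => b _; rewrite scalerA coefZ.
Qed.

Lemma lext0 f : lext f 0 = 0.
Proof. by rewrite -(scale0r 0) lextZ scale0r. Qed.

Lemma lext_mon f b : lext f (mon b) = f b.
Proof.
rewrite (@lextw f (mon b) [fset b]%fset) ?msupp_mon //.
by rewrite big_seq_fset1 coef_mon eqxx scale1r.
Qed.

Lemma span_ind (P : span B -> Prop) : P 0 ->
  (forall c u v, P u -> P v -> P (c *: u + v)) -> (forall b, P (mon b)) ->
  forall u, P u.
Proof.
move=> P0 PD Pm u; rewrite (spanE u); elim/big_ind: _ => // [x y Px Py|b _].
  by rewrite -[x]scale1r; apply: PD.
by rewrite -[_ *: _]addr0; apply: PD.
Qed.

End Lext.

Lemma lext_lin (B : ibasisType) (V : lmodType 'F_2) (c : 'F_2) (f g : B -> V) u :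
  lext (fun b => c *: f b + g b) u = c *: lext f u + lext g u.
Proof.
rewrite /lext scaler_sumr -big_split /=; apply: eq_bigr => b _.
by rewrite scalerDr !scalerA mulrC.
Qed.

Lemma eq_lext (B : ibasisType) (V : lmodType 'F_2) (f g : B -> V) u :
  f =1 g -> lext f u = lext g u.
Proof. by move=> e; apply: eq_bigr => b _; rewrite e. Qed.

(* Algebras over I with a basis [B] of monomials containing the idempotents and
   such that the product of two monomials is a monomial or 0 ([None]).        *)
HB.mixin Record hasPMul B of IBasis B := {
  pone : idem -> B;
  pone_idem : forall e, lidem (pone e) = e /\ ridem (pone e) = e;
  pmul : B -> B -> option B;
  pmul1l : forall e b, pmul (pone e) b = if e == lidem b then Some b else None;
  pmulr1 : forall e b, pmul b (pone e) = if ridem b == e then Some b else None;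
  pmulA : forall a b c,
    obind (pmul a) (pmul b c) = obind (fun x => pmul x c) (pmul a b);
  pmul_idem : forall a b c, pmul a b = Some c ->
    [/\ ridem a = lidem b, lidem c = lidem a & ridem c = ridem b]
}.

#[short(type="pmonType")]
HB.structure Definition PMon := { B of IBasis B & hasPMul B }.

Section Algebra.
Variable B : pmonType.
Implicit Types (u v w : span B).

Definition amul u v : span B :=
  lext (fun a => lext (fun b => omon (pmul a b)) v) u.
Definition aone : span B := mon (pone false) + mon (pone true).

Lemma amul_mon a b : amul (mon a) (mon b) = omon (pmul a b).
Proof. by rewrite /amul !lext_mon. Qed.

Lemma amulLl c u v w : amul (c *: u + v) w = c *: amul u w + amul v w.
Proof. by rewrite /amul lextD lextZ. Qed.

Lemma amulLr c u v w : amul w (c *: u + v) = c *: amul w u + amul w v.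
Proof.
rewrite /amul; etransitivity; last exact: lext_lin.
by apply: eq_lext => b; rewrite lextD lextZ.
Qed.


Lemma amul0l w : amul 0 w = 0. Proof. exact: lext0. Qed.

Lemma amul0r w : amul w 0 = 0.
Proof. by apply: big1 => b _; rewrite lext0 scaler0. Qed.

Lemma amul_omon a o : amul (mon a) (omon o) = omon (obind (pmul a) o).
Proof. by case: o => [b|] /=; rewrite ?amul_mon ?amul0r. Qed.

Lemma omon_amul b o :
  amul (omon o) (mon b) = omon (obind (fun x => pmul x b) o).
Proof. by case: o => [a|] /=; rewrite ?amul_mon ?amul0l. Qed.

Lemma amulA : associative amul.
Proof.
move=> u v w; elim/span_ind: u => [|c u u' IHu IHu'|a].
- by rewrite !amul0l.
- by rewrite !amulLl IHu IHu'.
elim/span_ind: v => [|c v v' IHv IHv'|b].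
- by rewrite amul0l amul0r amul0l.
- by rewrite amulLl amulLr amulLr amulLl IHv IHv'.
elim/span_ind: w => [|c w w' IHw IHw'|d].
- by rewrite !amul0r.
- by rewrite !amulLr IHw IHw'.
by rewrite !amul_mon amul_omon omon_amul pmulA.
Qed.

Lemma amulDl : left_distributive amul +%R.
Proof. by move=> u v w; rewrite -[u]scale1r amulLl !scale1r. Qed.

Lemma amulDr : right_distributive amul +%R.
Proof. by move=> w u v; rewrite -[u]scale1r amulLr !scale1r. Qed.

Lemma amul1 : left_id aone amul.
Proof.
move=> u; elim/span_ind: u => [|c u v IHu IHv|b]; first exact: amul0r.
  by rewrite amulLr IHu IHv.
rewrite amulDl !amul_mon !pmul1l.
by case: (lidem b) => /=; rewrite ?addr0 ?add0r.
Qed.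

Lemma amulr1 : right_id aone amul.
Proof.
move=> u; elim/span_ind: u => [|c u v IHu IHv|b]; first exact: amul0l.
  by rewrite amulLl IHu IHv.
rewrite amulDr !amul_mon !pmulr1.
by case: (ridem b) => /=; rewrite ?addr0 ?add0r.
Qed.

Lemma aone_neq0 : aone != 0.
Proof.
apply/eqP => /(congr1 (fun u : span B => u@_(pone false))).
rewrite coefD coef0 !coef_mon eqxx.
case: eqP => [/(congr1 (@lidem B))|_]; last by rewrite addr0 => /eqP.
by rewrite !(pone_idem _).1.
Qed.

HB.instance Definition _ := GRing.Zmodule_isNzRing.Build (span B)
  amulA amul1 amulr1 amulDl amulDr aone_neq0.

Lemma span_scaleAl (c : 'F_2) u v : c *: (u * v) = (c *: u) * v.
Proof.
have := amulLl c u 0 v; rewrite addr0 amul0l addr0 => e; exact: esym e.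
Qed.

HB.instance Definition _ :=
  GRing.Lmodule_isLalgebra.Build 'F_2 (span B) span_scaleAl.

Lemma span_scaleAr (c : 'F_2) u v : c *: (u * v) = u * (c *: v).
Proof.
have := amulLr c v 0 u; rewrite addr0 amul0r addr0 => e; exact: esym e.
Qed.

HB.instance Definition _ :=
  GRing.Lalgebra_isAlgebra.Build 'F_2 (span B) span_scaleAr.

Lemma mul_mon (a b : B) : mon a * mon b = omon (pmul a b).
Proof. exact: amul_mon. Qed.

End Algebra.

(* The ground ring I, as the algebra with basis {i_0, i_1}.                   *)
HB.instance Definition _ := Choice.on idem.
HB.instance Definition _ := hasIdems.Build idem id id.

Definition idem_mul (e f : idem) : option idem := if e == f then Some f else None.

Fact idem_mulr1 e f : idem_mul f e = if f == e then Some f else None.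
Proof. by case: e f => [] []. Qed.
Fact idem_mulA a b c :
  obind (idem_mul a) (idem_mul b c) = obind (idem_mul^~ c) (idem_mul a b).
Proof. by case: a b c => [] [] []. Qed.
Fact idem_mul_idem (a b c : idem) : idem_mul a b = Some c ->
  [/\ ridem a = lidem b, lidem c = lidem a & ridem c = ridem b].
Proof. by case: a b c => [] [] []. Qed.

HB.instance Definition _ := hasPMul.Build idem (fun e => conj erefl erefl)
  (fun _ _ => erefl) idem_mulr1 idem_mulA idem_mul_idem.

Definition Iring := span idem.

(* Tensor product over I: a basis is given by the pairs whose inner idempotents
   agree, the other elementary tensors being zero.                            *)
Definition tbasis (A B : ibasisType) : Type :=
  {p : A * B | ridem p.1 == lidem p.2}.
HB.instance Definition _ (A B : ibasisType) := SubChoice.on (tbasis A B).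
HB.instance Definition _ (A B : ibasisType) := hasIdems.Build (tbasis A B)
  (fun p => lidem (sval p).1) (fun p => ridem (sval p).2).

Section Tensor.
Variables A B : ibasisType.

Definition tens_mon (a : A) (b : B) : span (tbasis A B) :=
  omon (insub (a, b) : option (tbasis A B)).
Definition tens (u : span A) (v : span B) : span (tbasis A B) :=
  lext (fun a => lext (tens_mon a) v) u.

Lemma tens_monE (a : A) (b : B) : tens (mon a) (mon b) = tens_mon a b.
Proof. by rewrite /tens !lext_mon. Qed.

End Tensor.

(* The span of the dual basis; [b] stands here for b^*.                       *)
Definition dual (B : Type) : Type := B.
HB.instance Definition _ (B : ibasisType) := Choice.on (dual B).
HB.instance Definition _ (B : ibasisType) :=
  hasIdems.Build (dual B) (@ridem B) (@lidem B).

Definition star (B : ibasisType) (b : B) : span (dual B) := mon (b : dual B).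

(* The functional [f] as a combination of the b^*, when it has finite support;
   [dual_ofE] is then f = \sum_x f(x) x^*.                                    *)
Definition dual_of (B : ibasisType) (f : span B -> 'F_2) : span (dual B) :=
  \sum_(x \in [set: B]) f (mon x) *: star x.

Lemma dual_ofE (B : ibasisType) (f : span B -> 'F_2) (x : B) :
  finite_set [set x : B | f (mon x) != 0] -> (dual_of f)@_x = f (mon x).
Proof.
case/finite_fsetP => X /seteqP [sX _].
rewrite /dual_of (fsbigTE X) => [|y yX]; last first.
  have [->|ny] := eqVneq (f (mon y)) 0; first by rewrite scale0r.
  by have := sX y ny; rewrite /= (negPf yX).
rewrite (@coef_sum (dual B)); have [xX|xX] := boolP (x \in X).
  rewrite (big_fsetD1 x) //= coefZ coef_mon eqxx mulr1 big1_fset ?addr0 //.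
  by move=> a; rewrite !inE => /andP[ab _] _; rewrite coefZ coef_mon (negPf ab) mulr0.
rewrite big1_fset; last first.
  move=> a aX _; rewrite coefZ coef_mon.
  by case: eqP => [e|_]; rewrite ?mulr0 //; move: xX; rewrite -e aX.
have [//|ny] := eqVneq (f (mon x)) 0.
by have := sX x ny; rewrite /= (negPf xX).
Qed.

(* The algebra K: monomials
     [KWZ i j]   = W^i Z^j         in I_0 K I_0,
     [KUT k j]   = U^k T^j         in I_1 K I_1,
     [KUTs c k j] = U^k T^j sigma  in I_1 K I_0 if c = true,
                  = U^k T^j tau    in I_1 K I_0 if c = false.                *)
Inductive Kmon :=
  | KWZ of nat & nat
  | KUT of nat & int
  | KUTs of bool & nat & int.

Definition Kmon_code (a : Kmon) : (nat * nat) + (nat * int) + (bool * nat * int) :=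
  match a with
  | KWZ i j => inl (inl (i, j))
  | KUT k j => inl (inr (k, j))
  | KUTs c k j => inr (c, k, j)
  end.
Definition Kmon_decode x : Kmon :=
  match x with
  | inl (inl (i, j)) => KWZ i j
  | inl (inr (k, j)) => KUT k j
  | inr (c, k, j) => KUTs c k j
  end.
Fact Kmon_codeK : cancel Kmon_code Kmon_decode.
Proof. by case. Qed.
HB.instance Definition _ := Choice.copy Kmon (can_type Kmon_codeK).
HB.instance Definition _ := hasIdems.Build Kmon
  (fun a => if a is KWZ _ _ then false else true)
  (fun a => if a is KUT _ _ then true else false).

Definition Kone (e : idem) : Kmon := if e then KUT 0 0 else KWZ 0 0.

Definition Kmul (a b : Kmon) : option Kmon :=
  match a, b with
  | KWZ i j, KWZ p q => Some (KWZ (i + p) (j + q))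
  | KUT k j, KUT p q => Some (KUT (k + p) (j + q))
  | KUT k j, KUTs c p q => Some (KUTs c (k + p) (j + q))
  (* sigma W = U T^-1 sigma, sigma Z = T sigma,
     tau W = T^-1 tau, tau Z = U T tau *)
  | KUTs c k j, KWZ p q => Some (KUTs c (k + (if c then p else q)) (j - p%:Z + q%:Z))
  | _, _ => None
  end.

Fact Kone_idem e : lidem (Kone e) = e /\ ridem (Kone e) = e.
Proof. by case: e. Qed.
Fact Kmul1l e a : Kmul (Kone e) a = if e == lidem a then Some a else None.
Proof. by case: e a => [] [i j|k j|c k j] //=; rewrite add0r. Qed.
Fact Kmulr1 e a : Kmul a (Kone e) = if ridem a == e then Some a else None.
Proof.
case: e a => [] [i j|k j|c k j] //=; rewrite ?addr0 ?addn0 //.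
by case: c; rewrite ?addn0 -?[Posz 0]/(0%R) ?subr0 ?addr0.
Qed.
Fact KmulA a b c :
  obind (Kmul a) (Kmul b c) = obind (Kmul^~ c) (Kmul a b).
Proof.
case: a b c => [i j|k j|s k j] [i' j'|k' j'|s' k' j'] [p q|p q|s'' p q] //=;
  rewrite ?addnA ?addrA //; do ?[by congr (Some (KUTs _ _ _)); rewrite ?addrA].
congr (Some _); congr KUTs; first by case: s; rewrite addnA.
by rewrite !PoszD opprD !addrA; congr (_ + _); rewrite addrAC.
Qed.
Fact Kmul_idem (a b c : Kmon) : Kmul a b = Some c ->
  [/\ ridem a = lidem b, lidem c = lidem a & ridem c = ridem b].
Proof. by case: a b => [i j|k j|s k j] [p q|p q|s' p q] //= [] <-. Qed.
HB.instance Definition _ :=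
  hasPMul.Build Kmon Kone_idem Kmul1l Kmulr1 KmulA Kmul_idem.

Definition K := span Kmon.

Definition a_W : K := mon (KWZ 1 0).
Definition a_Z : K := mon (KWZ 0 1).
Definition a_U (e : idem) : K := mon (if e then KUT 1 0 else KWZ 1 1).
Definition a_T : K := mon (KUT 0 1).
Definition a_Ti : K := mon (KUT 0 (-1)).
Definition a_sigma : K := mon (KUTs true 0 0).
Definition a_tau : K := mon (KUTs false 0 0).

Lemma K_relations :
  [/\ a_sigma * a_W = a_U true * a_Ti * a_sigma, a_sigma * a_Z = a_T * a_sigma,
      a_tau * a_W = a_Ti * a_tau, a_tau * a_Z = a_U true * a_T * a_tau
    & a_U false = a_W * a_Z].
Proof. by split; rewrite !mul_mon /= ?mul_mon. Qed.

(* Words in two letters without repetition. In idempotent 0 the letter [true]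
   is z and [false] is w; in idempotent 1 [true] is phi_+ and [false] is phi_-. *)
Definition alternating (u : seq bool) : bool := sorted (fun x y => x != y) u.
Definition altword : Type := {u : seq bool | alternating u}.
HB.instance Definition _ := SubChoice.on altword.

(* The algebra K^!: monomials
     [D0 u e]   = u theta^e in I_0 K^! I_0,  u an alternating word in w, z,
     [D1 u e]   = u theta^e in I_1 K^! I_1,  u an alternating word in phi_+-,
     [DS c p e] in I_0 K^! I_1: s theta^e, z s theta^e (c = true),
                t theta^e, w t theta^e (c = false), for p = false, true.
   So with l_c = z, s_c = s, phi_c = phi_+ for c = true and l_c = w, s_c = t,
   phi_c = phi_- for c = false, one has [DS c p e] = l_c^p s_c theta^e
   = s_c phi_c^p theta^e, while l_b s_c = s_c phi_b = 0 for b != c.           *)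
Inductive Dmon :=
  | D0 of altword & bool
  | D1 of altword & bool
  | DS of bool & bool & bool.

Definition Dmon_code (x : Dmon) :
    (altword * bool) + (altword * bool) + (bool * bool * bool) :=
  match x with
  | D0 u e => inl (inl (u, e))
  | D1 u e => inl (inr (u, e))
  | DS c p e => inr (c, p, e)
  end.
Definition Dmon_decode x : Dmon :=
  match x with
  | inl (inl (u, e)) => D0 u e
  | inl (inr (u, e)) => D1 u e
  | inr (c, p, e) => DS c p e
  end.
Fact Dmon_codeK : cancel Dmon_code Dmon_decode.
Proof. by case. Qed.
HB.instance Definition _ := Choice.copy Dmon (can_type Dmon_codeK).
HB.instance Definition _ := hasIdems.Build Dmon
  (fun x => if x is D1 _ _ then true else false)
  (fun x => if x is D0 _ _ then false else true).

(* The elements v theta^e, v theta^e and v s_c theta^e (or s_c v theta^e) of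
   K^! for an arbitrary word v.                                               *)
Definition word0 (v : seq bool) (e : bool) : option Dmon :=
  omap (fun u : altword => D0 u e) (insub v).
Definition word1 (v : seq bool) (e : bool) : option Dmon :=
  omap (fun u : altword => D1 u e) (insub v).
Definition wordS (c : bool) (v : seq bool) (e : bool) : option Dmon :=
  if v == [::] then Some (DS c false e)
  else if v == [:: c] then Some (DS c true e) else None.

Definition Done (e : idem) : Dmon :=
  if e then D1 (exist _ [::] isT) false else D0 (exist _ [::] isT) false.

Definition Dmul (x y : Dmon) : option Dmon :=
  match x, y with
  | D0 u e, D0 v f =>
      if e && f then None else word0 (val u ++ val v) (e || f)
  | D1 u e, D1 v f =>
      if e && f then None else word1 (val u ++ val v) (e || f)
  | D0 u e, DS c p f =>
      if e && f then None else wordS c (val u ++ nseq p c) (e || f)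
  | DS c p e, D1 v f =>
      if e && f then None else wordS c (nseq p c ++ val v) (e || f)
  | _, _ => None
  end.

Fact word0E (u : altword) e : word0 (val u) e = Some (D0 u e).
Proof. by rewrite /word0 valK. Qed.
Fact word1E (u : altword) e : word1 (val u) e = Some (D1 u e).
Proof. by rewrite /word1 valK. Qed.
Fact wordSE c (p : bool) e : wordS c (nseq p c) e = Some (DS c p e).
Proof. by case: p => //; rewrite /wordS /= eqxx. Qed.

Fact alternating_cat u v :
  alternating (u ++ v) -> alternating u /\ alternating v.
Proof. by case/cat_sorted2. Qed.

Fact word0_None v e : ~~ alternating v -> word0 v e = None.
Proof. by move=> nv; rewrite /word0 insubN. Qed.
Fact word1_None v e : ~~ alternating v -> word1 v e = None.
Proof. by move=> nv; rewrite /word1 insubN. Qed.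
Fact wordS_None c v e : ~~ alternating v -> wordS c v e = None.
Proof. by case: v => [|a [|b v]] //= _; rewrite /wordS /= eqseq_cons andbF. Qed.
Fact wordS_SomeE c v e : (exists p : bool, v = nseq p c) \/ wordS c v e = None.
Proof.
rewrite /wordS; case: eqP => [->|_]; first by left; exists false.
by case: eqP => [->|_]; [left; exists true | right].
Qed.

Variant wordS_spec c e : option Dmon -> Prop :=
  | WordSNone : wordS_spec c e None
  | WordSSome (p : bool) : wordS_spec c e (Some (DS c p e)).
Fact wordSP c v e : wordS_spec c e (wordS c v e).
Proof. by rewrite /wordS; case: ifP => _; [|case: ifP => _]; constructor. Qed.

Fact word0_mul0 v e (u : altword) f :
  obind (Dmul^~ (D0 u f)) (word0 v e) =
  if e && f then None else word0 (v ++ val u) (e || f).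
Proof.
have [va|nv] := boolP (alternating v).
  by rewrite -[v]/(val (Sub v va : altword)) word0E.
rewrite word0_None //= word0_None ?if_same //.
by apply: contra nv => /alternating_cat [].
Qed.
Fact mul0_word0 v e (u : altword) f :
  obind (Dmul (D0 u f)) (word0 v e) =
  if f && e then None else word0 (val u ++ v) (f || e).
Proof.
have [va|nv] := boolP (alternating v).
  by rewrite -[v]/(val (Sub v va : altword)) word0E.
rewrite word0_None //= word0_None ?if_same //.
by apply: contra nv => /alternating_cat [].
Qed.
Fact word1_mul1 v e (u : altword) f :
  obind (Dmul^~ (D1 u f)) (word1 v e) =
  if e && f then None else word1 (v ++ val u) (e || f).
Proof.
have [va|nv] := boolP (alternating v).
  by rewrite -[v]/(val (Sub v va : altword)) word1E.
rewrite word1_None //= word1_None ?if_same //.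
by apply: contra nv => /alternating_cat [].
Qed.
Fact mul1_word1 v e (u : altword) f :
  obind (Dmul (D1 u f)) (word1 v e) =
  if f && e then None else word1 (val u ++ v) (f || e).
Proof.
have [va|nv] := boolP (alternating v).
  by rewrite -[v]/(val (Sub v va : altword)) word1E.
rewrite word1_None //= word1_None ?if_same //.
by apply: contra nv => /alternating_cat [].
Qed.
Fact word0_mulS v e c (p : bool) f :
  obind (Dmul^~ (DS c p f)) (word0 v e) =
  if e && f then None else wordS c (v ++ nseq p c) (e || f).
Proof.
have [va|nv] := boolP (alternating v).
  by rewrite -[v]/(val (Sub v va : altword)) word0E.
rewrite word0_None //= wordS_None ?if_same //.
by apply: contra nv => /alternating_cat [].
Qed.
Fact mulS_word1 v e c (p : bool) f :
  obind (Dmul (DS c p f)) (word1 v e) =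
  if f && e then None else wordS c (nseq p c ++ v) (f || e).
Proof.
have [va|nv] := boolP (alternating v).
  by rewrite -[v]/(val (Sub v va : altword)) word1E.
rewrite word1_None //= wordS_None ?if_same //.
by apply: contra nv => /alternating_cat [].
Qed.
Fact wordS_cat_None c v v' e f :
  wordS c v e = None -> wordS c (v ++ v') f = None /\ wordS c (v' ++ v) f = None.
Proof.
case: v => [|a [|b v]] //; last first.
  by case: v' => [|x [|y v']]; rewrite /wordS /= ?cats0 !eqseq_cons ?andbF.
rewrite /wordS /= !eqseq_cons !andbT => ac.
by case: v' => [|x [|y v']] //=; rewrite ?eqseq_cons ?andbT ?andbF //; case: (a == c) ac.
Qed.
Fact wordS_mul1 c v e (u : altword) f :
  obind (Dmul^~ (D1 u f)) (wordS c v e) =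
  if e && f then None else wordS c (v ++ val u) (e || f).
Proof.
case: (wordS_SomeE c v e) => [[p ->]|n]; first by rewrite wordSE.
by rewrite n /= (wordS_cat_None _ _ n).1 if_same.
Qed.
Fact mul0_wordS c v e (u : altword) f :
  obind (Dmul (D0 u f)) (wordS c v e) =
  if f && e then None else wordS c (val u ++ v) (f || e).
Proof.
case: (wordS_SomeE c v e) => [[p ->]|n]; first by rewrite wordSE.
by rewrite n /= (wordS_cat_None _ _ n).2 if_same.
Qed.

Fact Done_idem e : lidem (Done e) = e /\ ridem (Done e) = e.
Proof. by case: e. Qed.
Fact Dmul1l e x : Dmul (Done e) x = if e == lidem x then Some x else None.
Proof.
by case: e x => [] [u f|u f|c p f] //=; rewrite ?word0E ?word1E ?wordSE.
Qed.
Fact Dmulr1 e x : Dmul x (Done e) = if ridem x == e then Some x else None.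
Proof.
case: e x => [] [u f|u f|c p f] //=; rewrite ?andbF ?orbF ?cats0 //;
  by rewrite ?word0E ?word1E ?wordSE.
Qed.

Fact if_None (T S : Type) (f : T -> option S) (b : bool) (o : option T) :
  obind f (if b then None else o) = if b then None else obind f o.
Proof. by case: b. Qed.

Fact DmulA x y z :
  obind (Dmul x) (Dmul y z) = obind (Dmul^~ z) (Dmul x y).
Proof.
have none T (b : bool) : (if b then None else None) = None :> option T
  by case: b.
case: x y z => [u e|u e|c p e] [v f|v f|d q f] [w g|w g|r s g];
  rewrite ?[Dmul (D0 _ _) _]/= ?[Dmul (D1 _ _) _]/= ?[Dmul (DS _ _ _) _]/=;
  rewrite ?if_None ?mul0_word0 ?word0_mul0 ?mul1_word1 ?word1_mul1;
  rewrite ?mulS_word1 ?word0_mulS ?mul0_wordS ?wordS_mul1 //.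
all: try by case: e f g => [] [] []; rewrite /= ?catA.
all: case: (_ && _) => //; rewrite /word0 /word1.
all: by [case: (insub _) | case: (wordSP _ _ _)].
Qed.

Fact Dmul_idem (x y z : Dmon) : Dmul x y = Some z ->
  [/\ ridem x = lidem y, lidem z = lidem x & ridem z = ridem y].
Proof.
case: x y => [u e|u e|c p e] [v f|v f|d q f] //=; case: (_ && _) => //.
- by rewrite /word0; case: (insub _) => //= w [] <-.
- by case: (wordSP _ _ _) => // r [] <-.
- by rewrite /word1; case: (insub _) => //= w [] <-.
- by case: (wordSP _ _ _) => // r [] <-.
Qed.

HB.instance Definition _ :=
  hasPMul.Build Dmon Done_idem Dmul1l Dmulr1 DmulA Dmul_idem.

(* K^! *)
Definition Kd := span Dmon.

Definition bword0 (v : seq bool) (e : bool) : Kd := omon (word0 v e).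
Definition bword1 (v : seq bool) (e : bool) : Kd := omon (word1 v e).
Definition bwordS (c : bool) (v : seq bool) (e : bool) : Kd :=
  omon (wordS c v e).

Definition b_w : Kd := bword0 [:: false] false.
Definition b_z : Kd := bword0 [:: true] false.
Definition b_theta (e : idem) : Kd :=
  if e then bword1 [::] true else bword0 [::] true.
Definition b_phip : Kd := bword1 [:: true] false.
Definition b_phim : Kd := bword1 [:: false] false.
Definition b_s : Kd := bwordS true [::] false.
Definition b_t : Kd := bwordS false [::] false.

Fact omon_mul (x y : option Dmon) :
  omon x * omon y = omon (obind (fun a => obind (Dmul a) y) x).
Proof.
by case: x y => [a|] [b|] /=; rewrite ?mulr0 ?mul0r //; apply: mul_mon.
Qed.

Lemma bword00 v e w f :
  bword0 v e * bword0 w f = if e && f then 0 else bword0 (v ++ w) (e || f).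
Proof.
have [wa|nw] := boolP (alternating w); last first.
  rewrite /bword0 (word0_None f nw) /= mulr0 word0_None ?if_same //.
  by apply: contra nw => /alternating_cat [].
rewrite /bword0 omon_mul -[w]/(val (Sub w wa : altword)) word0E /=.
by rewrite (word0_mul0 v e (Sub w wa)); case: (e && f).
Qed.
Lemma bword11 v e w f :
  bword1 v e * bword1 w f = if e && f then 0 else bword1 (v ++ w) (e || f).
Proof.
have [wa|nw] := boolP (alternating w); last first.
  rewrite /bword1 (word1_None f nw) /= mulr0 word1_None ?if_same //.
  by apply: contra nw => /alternating_cat [].
rewrite /bword1 omon_mul -[w]/(val (Sub w wa : altword)) word1E /=.
by rewrite (word1_mul1 v e (Sub w wa)); case: (e && f).
Qed.
Lemma bword0S v e c w f :
  bword0 v e * bwordS c w f = if e && f then 0 else bwordS c (v ++ w) (e || f).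
Proof.
rewrite /bword0 /bwordS omon_mul; case: (wordS_SomeE c w f) => [[p ->]|n].
  by rewrite wordSE word0_mulS; case: (e && f).
rewrite n (wordS_cat_None _ _ n).2 if_same.
by case: word0.
Qed.
Lemma bwordS1 c v e w f :
  bwordS c v e * bword1 w f = if e && f then 0 else bwordS c (v ++ w) (e || f).
Proof.
rewrite /bword1 /bwordS omon_mul; case: (wordS_SomeE c v e) => [[p ->]|n].
  by rewrite wordSE /= mulS_word1; case: (e && f).
by rewrite n (wordS_cat_None _ _ n).1 if_same.
Qed.

Lemma bword0_eq0 v e : ~~ alternating v -> bword0 v e = 0.
Proof. by rewrite /bword0 => /word0_None ->. Qed.
Lemma bword1_eq0 v e : ~~ alternating v -> bword1 v e = 0.
Proof. by rewrite /bword1 => /word1_None ->. Qed.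

Lemma Kd_relations0 :
  [/\ b_w * b_w = 0, b_z * b_z = 0, b_theta false * b_theta false = 0,
      b_theta false * b_w = b_w * b_theta false
    & b_theta false * b_z = b_z * b_theta false].
Proof. by split; rewrite !bword00 //= bword0_eq0. Qed.

Lemma Kd_relations1 :
  [/\ b_phip * b_phip = 0, b_phim * b_phim = 0, b_theta true * b_theta true = 0,
      b_theta true * b_phip = b_phip * b_theta true
    & b_theta true * b_phim = b_phim * b_theta true].
Proof. by split; rewrite !bword11 //= bword1_eq0. Qed.

Lemma Kd_relations01 :
  [/\ [/\ b_w * b_s = 0, b_z * b_t = 0, b_s * b_phim = 0 & b_t * b_phip = 0],
      b_theta false * b_s = b_s * b_theta true,
      b_theta false * b_t = b_t * b_theta true,
      b_z * b_s = b_s * b_phip & b_w * b_t = b_t * b_phim].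
Proof. by rewrite !bword0S !bwordS1. Qed.

(* mu_1 is given by the Leibniz rule; theta is placed at the right end of a
   monomial in idempotent 0 and at the left end, in idempotent 0, of a monomial
   of I_0 K^! I_1.                                                            *)
Definition mu1_mon (x : Dmon) : Kd :=
  match x with
  | D0 u true => mon (D0 u false) * (b_w * b_z + b_z * b_w)
  | DS c p true => (b_w * b_z + b_z * b_w) * mon (DS c p false)
  | _ => 0
  end.
Definition mu1 : Kd -> Kd := lext mu1_mon.

Definition mu0 : Kd := b_phip * b_phim + b_phim * b_phip.

Lemma mon_D0 u e : mon (D0 u e) = bword0 (val u) e.
Proof. by rewrite /bword0 word0E. Qed.
Lemma mon_D1 u e : mon (D1 u e) = bword1 (val u) e.
Proof. by rewrite /bword1 word1E. Qed.
Lemma mon_DS c (p : bool) e : mon (DS c p e) = bwordS c (nseq p c) e.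
Proof. by rewrite /bwordS wordSE. Qed.

Lemma mul_bword01 v e w f : bword0 v e * bword1 w f = 0.
Proof.
by rewrite /bword0 /bword1 omon_mul /word0 /word1; case: (insub v); case: (insub w).
Qed.
Lemma mul_bword10 v e w f : bword1 v e * bword0 w f = 0.
Proof.
by rewrite /bword0 /bword1 omon_mul /word0 /word1; case: (insub v); case: (insub w).
Qed.
Lemma mul_bword1S v e c w f : bword1 v e * bwordS c w f = 0.
Proof.
rewrite /bwordS /bword1 omon_mul /word1; case: (insub v) => // u.
by case: (wordSP _ _ _).
Qed.
Lemma mul_bwordS0 c v e w f : bwordS c v e * bword0 w f = 0.
Proof.
rewrite /bwordS /bword0 omon_mul /word0; case: (insub w) => [u|];
  by case: (wordSP _ _ _).
Qed.
Lemma mul_bwordSS c v e d w f : bwordS c v e * bwordS d w f = 0.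
Proof.
by rewrite /bwordS omon_mul; case: (wordSP c v e); case: (wordSP d w f).
Qed.

Section Leibniz.
Let delta : Kd := b_w * b_z + b_z * b_w.

Let deltaE : delta = bword0 [:: false; true] false + bword0 [:: true; false] false.
Proof. by rewrite /delta !bword00. Qed.

Let delta_S c v e : delta * bwordS c v e = 0.
Proof.
rewrite deltaE mulrDl !bword0S /bwordS /wordS /= !eqseq_cons !andbF.
by rewrite addr0.
Qed.

Let delta_comm v e : delta * bword0 v e = bword0 v e * delta.
Proof.
elim: v => [|a v IHv].
  by rewrite deltaE mulrDl mulrDr !bword00 /= andbF orbF.
have -> : bword0 (a :: v) e = bword0 [:: a] false * bword0 v e.
  by rewrite bword00.
rewrite mulrA -[RHS]mulrA -IHv !mulrA; congr (_ * _).
rewrite deltaE mulrDl mulrDr !bword00 /=.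
case: a => /=.
  by rewrite [X in X + _]bword0_eq0 // [X in _ = _ + X]bword0_eq0 // addrC.
by rewrite [X in _ + X = _]bword0_eq0 // [X in _ = X + _]bword0_eq0 // addrC.
Qed.

Let delta_01 v e w f : bword0 v e * delta * bword1 w f = 0.
Proof. by rewrite -delta_comm -mulrA mul_bword01 mulr0. Qed.

Let mu1_0 v e : mu1 (bword0 v e) = if e then bword0 v false * delta else 0.
Proof.
rewrite /bword0 /word0; case: insubP => [u _ uv|_] /=.
  by rewrite /mu1 lext_mon; case: e.
by rewrite /mu1 lext0 mul0r if_same.
Qed.
Let mu1_1 v e : mu1 (bword1 v e) = 0.
Proof.
rewrite /bword1 /word1; case: insubP => [u _ uv|_] /=.
  by rewrite /mu1 lext_mon.
by rewrite /mu1 lext0.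
Qed.
Let mu1_S c v e : mu1 (bwordS c v e) = 0.
Proof.
rewrite /bwordS; case: (wordSP c v e) => [|p] /=; first exact: lext0.
by rewrite /mu1 lext_mon; case: e => //=; rewrite mon_DS; apply: delta_S.
Qed.

Let double0 (x : Kd) : x + x = 0.
Proof.
have -> : x + x = (1 + 1 : 'F_2) *: x by rewrite scalerDl scale1r.
by rewrite (_ : 1 + 1 = 0) ?scale0r //; apply/val_inj.
Qed.

Let mu1D c x y : mu1 (c *: x + y) = c *: mu1 x + mu1 y.
Proof. by rewrite /mu1 lextD lextZ. Qed.

Lemma mu1_leibniz x y : mu1 (x * y) = mu1 x * y + x * mu1 y.
Proof.
elim/span_ind: x => [|c x x' IHx IHx'|a].
- by rewrite /mu1 !mul0r lext0 mul0r addr0.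
- rewrite mulrDl -scalerAl mu1D IHx IHx' mu1D !mulrDl -!scalerAl scalerDr.
  by rewrite addrACA.
elim/span_ind: y => [|c y y' IHy IHy'|b].
- by rewrite /mu1 !mulr0 lext0 mulr0 addr0.
- rewrite mulrDr -scalerAr mu1D IHy IHy' mu1D !mulrDr -!scalerAr scalerDr.
  by rewrite addrACA.
case: a b => [u e|u e|c p e] [v f|v f|d q f];
  rewrite ?mon_D0 ?mon_D1 ?mon_DS.
- rewrite bword00 !mu1_0; case: e f => [] [] /=.
  + rewrite /mu1 lext0 -mulrA delta_comm !mulrA !bword00 /= double0 //.
  + by rewrite mulr0 addr0 mu1_0 -mulrA delta_comm mulrA bword00.
  + by rewrite mul0r add0r mu1_0 mulrA bword00.
  + by rewrite mu1_0 mul0r mulr0 addr0.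
- rewrite mul_bword01 mu1_0 mu1_1 mulr0 addr0 /mu1 lext0.
  by case: e; rewrite ?delta_01 ?mul0r.
- rewrite bword0S mu1_S mulr0 addr0 mu1_0 (fun_if mu1) mu1_S /mu1 lext0 if_same.
  by case: e; rewrite ?mul0r // -mulrA delta_S mulr0.
- rewrite mul_bword10 mu1_1 mul0r add0r mu1_0 /mu1 lext0.
  by case: f; rewrite ?mulr0 // mulrA mul_bword10 mul0r.
- rewrite bword11 !mu1_1 mul0r mulr0 addr0 (fun_if mu1) mu1_1 /mu1 lext0.
  by rewrite if_same.
- by rewrite mul_bword1S mu1_1 mu1_S mul0r mulr0 addr0 /mu1 lext0.
- rewrite mul_bwordS0 mu1_S mul0r add0r mu1_0 /mu1 lext0.
  by case: f; rewrite ?mulr0 // mulrA mul_bwordS0 mul0r.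
- rewrite bwordS1 mu1_1 mu1_S mulr0 mul0r addr0 (fun_if mu1) mu1_S /mu1 lext0.
  by rewrite if_same.
- by rewrite mul_bwordSS !mu1_S mulr0 mul0r addr0 /mu1 lext0.
Qed.

Lemma mu1_gen :
  [/\ mu1 (b_theta false) = b_w * b_z + b_z * b_w, mu1 (b_theta true) = 0,
      mu1 b_w = 0 /\ mu1 b_z = 0, mu1 b_s = 0 /\ mu1 b_t = 0
    & mu1 b_phip = 0 /\ mu1 b_phim = 0].
Proof.
rewrite !mu1_0 !mu1_1 !mu1_S; split=> //.
by rewrite -/delta deltaE mulrDr !bword00.
Qed.

End Leibniz.

(* The right and left actions of K^! on its dual, and the dual of mu_1.       *)
Definition dual_mulr (y : Dmon) (b : Kd) : span (dual Dmon) :=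
  dual_of (fun x => (b * x)@_y).
Definition dual_mull (c : Kd) (y : Dmon) : span (dual Dmon) :=
  dual_of (fun x => (x * c)@_y).
Definition dual_mu1 (y : Dmon) : span (dual Dmon) :=
  dual_of (fun x => (mu1 x)@_y).

Section DualFinite.

Let fin1 (T : Type) (A : set T) : is_subset1 A -> finite_set A.
Proof.
move=> A1; have [-> //|/set0P [x Ax]] := eqVneq A set0.
by apply: (sub_finite_set _ (finite_set1 x)) => z Az; apply: A1.
Qed.

Let word0_inj v e x : word0 v e = Some x -> exists2 u, x = D0 u e & val u = v.
Proof.
by rewrite /word0; case: insubP => //= u _ <- [] <-; exists u.
Qed.
Let word1_inj v e x : word1 v e = Some x -> exists2 u, x = D1 u e & val u = v.
Proof.
by rewrite /word1; case: insubP => //= u _ <- [] <-; exists u.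
Qed.
Let wordS_inj c v e x : wordS c v e = Some x ->
  exists2 p : bool, x = DS c p e & v = nseq p c.
Proof.
rewrite /wordS; case: eqP => [-> [] <-|_]; first by exists false.
by case: eqP => // -> [] <-; exists true.
Qed.
Let nseq_inj (p q : bool) (c : bool) : nseq p c = nseq q c -> p = q.
Proof. by case: p q => [] []. Qed.

Let cat_injl (T : Type) (u v w : seq T) : u ++ v = u ++ w -> v = w.
Proof. by elim: u => //= a u IHu [] /IHu. Qed.
Let cat_injr (T : Type) (u v w : seq T) : v ++ u = w ++ u -> v = w.
Proof.
by move=> /(congr1 rev); rewrite !rev_cat => /cat_injl /(congr1 rev); rewrite !revK.
Qed.

Let Dmul_injl x y y' z : Dmul x y = Some z -> Dmul x y' = Some z -> y = y'.
Proof.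
case: x y y' => [u e|u e|c p e] [v f|v f|d q f] [v' f'|v' f'|d' q' f'] //=;
  case: ifP => // ef; case: ifP => // ef'.
- move=> /word0_inj [t -> tE] /word0_inj [t' [tt' ee'] t'E].
  move: tE; rewrite tt' t'E => /cat_injl /val_inj ->; congr D0.
  by case: e f f' ef ef' ee' => [] [] [].
- by move=> /word0_inj [t -> _] /wordS_inj [].
- by move=> /wordS_inj [t -> _] /word0_inj [].
- move=> /wordS_inj [t -> tE] /wordS_inj [t' [dd' tt' ee'] t'E].
  move: tE; rewrite tt' -dd' in t'E * => tE.
  move: t'E; rewrite -tE => /cat_injl /nseq_inj ->; congr DS.
  by case: e f f' ef ef' ee' => [] [] [].
- move=> /word1_inj [t -> tE] /word1_inj [t' [tt' ee'] t'E].
  move: tE; rewrite tt' t'E => /cat_injl /val_inj ->; congr D1.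
  by case: e f f' ef ef' ee' => [] [] [].
- move=> /wordS_inj [t -> tE] /wordS_inj [t' [tt' ee'] t'E].
  move: tE; rewrite tt' -t'E => /cat_injl /val_inj ->; congr D1.
  by case: e f f' ef ef' ee' => [] [] [].
Qed.

Let Dmul_injr x x' y z : Dmul x y = Some z -> Dmul x' y = Some z -> x = x'.
Proof.
case: y x x' => [u e|u e|c p e] [v f|v f|d q f] [v' f'|v' f'|d' q' f'] //=;
  case: ifP => // ef; case: ifP => // ef'.
- move=> /word0_inj [t -> tE] /word0_inj [t' [tt' ee'] t'E].
  move: tE; rewrite tt' t'E => /cat_injr /val_inj ->; congr D0.
  by case: e f f' ef ef' ee' => [] [] [].
- move=> /word1_inj [t -> tE] /word1_inj [t' [tt' ee'] t'E].
  move: tE; rewrite tt' t'E => /cat_injr /val_inj ->; congr D1.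
  by case: e f f' ef ef' ee' => [] [] [].
- by move=> /word1_inj [t -> _] /wordS_inj [].
- by move=> /wordS_inj [t -> _] /word1_inj [].
- move=> /wordS_inj [t -> tE] /wordS_inj [t' [dd' tt' ee'] t'E].
  move: t'E; rewrite -dd' -tt' -tE => /cat_injr /nseq_inj ->; congr DS.
  by case: e f f' ef ef' ee' => [] [] [].
- move=> /wordS_inj [t -> tE] /wordS_inj [t' [tt' ee'] t'E].
  move: tE; rewrite tt' -t'E => /cat_injr /val_inj ->; congr D0.
  by case: e f f' ef ef' ee' => [] [] [].
Qed.

Let omon_coef (B : ibasisType) (o : option B) (b : B) :
  (omon o)@_b != 0 -> o = Some b.
Proof.
case: o => [a|] /=; last by rewrite coef0 eqxx.
by rewrite coef_mon; have [->|_] := eqVneq a b; rewrite ?eqxx.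
Qed.

Lemma dual_mulrE y b (x : Dmon) : (dual_mulr y b)@_x = (b * mon x)@_y.
Proof.
rewrite /dual_mulr (dual_ofE (f := fun x => (b * x)@_y)); [by []|].
elim/span_ind: b => [|c u v IHu IHv|a].
- apply: (@sub_finite_set _ _ set0); last exact: finite_set0.
  by move=> z /=; rewrite mul0r coef0 eqxx.
- have := conj IHu IHv; rewrite -finite_setU; apply: sub_finite_set => z /=.
  rewrite mulrDl -scalerAl coefD coefZ; have [->|nz _] := eqVneq ((u * mon z)@_y) 0.
    by rewrite mulr0 add0r; right.
  by left.
apply: fin1 => z z' /=; rewrite !mul_mon => /omon_coef h /omon_coef.
exact: Dmul_injl.
Qed.

Lemma dual_mullE y c (x : Dmon) : (dual_mull c y)@_x = (mon x * c)@_y.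
Proof.
rewrite /dual_mull (dual_ofE (f := fun x => (x * c)@_y)); [by []|].
elim/span_ind: c => [|c u v IHu IHv|a].
- apply: (@sub_finite_set _ _ set0); last exact: finite_set0.
  by move=> z /=; rewrite mulr0 coef0 eqxx.
- have := conj IHu IHv; rewrite -finite_setU; apply: sub_finite_set => z /=.
  rewrite mulrDr -scalerAr coefD coefZ; have [->|nz _] := eqVneq ((mon z * u)@_y) 0.
    by rewrite mulr0 add0r; right.
  by left.
apply: fin1 => z z' /=; rewrite !mul_mon => /omon_coef h /omon_coef.
exact: Dmul_injr.
Qed.

Let mu1_supp x y : (mu1 (mon x))@_y != 0 ->
  exists u v, [/\ x = D0 u true, y = D0 v false & val u = take (size (val v)).-2 (val v)].
Proof.
case: x => [u [|]|u e|c p [|]]; rewrite /mu1 lext_mon /= ?coef0 ?eqxx //.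
  rewrite mon_D0 mulrDr !bword00 /= coefD => h.
  have {h} [a [b h]] : exists a b, (bword0 (val u ++ [:: a; b]) false)@_y != 0.
    have [h0|h0] := eqVneq ((bword0 (val u ++ [:: false; true]) false)@_y) 0.
      by exists true, false; move: h; rewrite h0 add0r.
    by exists false, true.
  case/omon_coef/word0_inj: h => v -> vE; exists u, v; split=> //.
  by rewrite vE size_cat addn2 /= take_size_cat.
by rewrite mon_DS mulrDl !bword00 !bword0S coefD /bwordS /wordS /=
  !eqseq_cons !andbF coef0 addr0 eqxx.
Qed.

Lemma dual_mu1E y (x : Dmon) : (dual_mu1 y)@_x = (mu1 (mon x))@_y.
Proof.
rewrite /dual_mu1 (dual_ofE (f := fun x => (mu1 x)@_y)); [by []|].
apply: fin1 => z z' /=.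
move=> /mu1_supp [u [v [-> -> uE]]] /mu1_supp [u' [v' [-> [<-] u'E]]].
by congr D0; apply: val_inj; rewrite uE.
Qed.

End DualFinite.

(* The bimodule L; [a \| xi] is a | xi, and [a \|* v] is a | v^* for monomials a
   and v, being 0 if [v] is [None].                                           *)
Definition Lmon : ibasisType := tbasis Kmon (dual Dmon).
Definition L := span Lmon.

Definition ostar (v : option Dmon) : span (dual Dmon) :=
  if v is Some y then star y else 0.

Notation "a \| xi" := (tens a xi : L) (at level 45, no associativity).
Notation "a \|* v" := (tens (mon a) (ostar v) : L) (at level 45, no associativity).

Definition Lext (V : lmodType 'F_2) (f : Kmon -> Dmon -> V) : L -> V :=
  lext (fun p : Lmon => f (sval p).1 (sval p).2).

Definition m110 (a' : K) : L -> L :=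
  Lext (fun a y => (a' * mon a) \| star y).

Definition m011 (v : L) (b : Kd) : L :=
  Lext (fun a y => mon a \| dual_mulr y b) v.

Definition m010_terms : seq (Kd * K) :=
  [:: (b_w, a_W); (b_z, a_Z); (b_s, a_sigma); (b_t, a_tau);
      (b_phip, a_T); (b_phim, a_Ti);
      (b_theta false, a_U false); (b_theta true, a_U true)].

Definition m010 : L -> L :=
  Lext (fun a y => mon a \| dual_mu1 y +
    \sum_(ce <- m010_terms) ((mon a * ce.2) \| dual_mull ce.1 y)).

Definition unrcons (u : seq bool) : option (seq bool * bool) :=
  if rev u is l :: r then Some (rev r, l) else None.

Lemma unrcons_rcons u l : unrcons (rcons u l) = Some (u, l).
Proof. by rewrite /unrcons rev_rcons revK. Qed.

Definition ends_in (l : bool) (u : seq bool) : bool :=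
  if unrcons u is Some (_, l') then l' == l else false.

(* T for [c = true], T^-1 for [c = false].                                    *)
Definition sgnT (c : bool) : int := if c then 1 else -1.

(* W^i Z^j lies in the span of the U^k W^n with n >= 0 (resp. n > 0) iff
   j <= i (resp. j < i), and is a power of U iff i = j. The clauses for sigma
   and tau are merged by means of [sgnT] and of the conventions of [DS].      *)
Definition d_mon (a : Kmon) (y : Dmon) : L :=
  match a, y with
  | KWZ i j, D0 u e =>
      match unrcons (val u) with
      | Some (v, false) => if (j <= i)%N then KWZ i.+1 j \|* word0 v e else 0
      | Some (v, true) => if (i <= j)%N then KWZ i j.+1 \|* word0 v e else 0
      | None => if e && (i == j) then KWZ i.+1 j.+1 \|* word0 [::] false else 0
      end
  | KUT k j, DS c p e => KUTs c k j \|* word0 (nseq p c) e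
  | KUTs c k j, D0 u e =>
      match unrcons (val u) with
      | Some (v, l) =>
          if (l == c) && ends_in (~~ c) v
          then KUTs c k (j + sgnT c) \|* word0 v e else 0
      | None => 0
      end
  | KUT k j, D1 u e =>
      match unrcons (val u) with
      | Some (v, true) => if 0 <= j then KUT k (j + 1) \|* word1 v e else 0
      | Some (v, false) => if j <= 0 then KUT k (j - 1) \|* word1 v e else 0
      | None => 0
      end
      + (if e then KUT k.+1 j \|* word1 (val u) false else 0)
  | _, _ => 0
  end.

Definition H_mon (a : Kmon) (y : Dmon) : L :=
  match a, y with
  | KWZ i j, D0 u e =>
      (if (j < i)%N then KWZ i.-1 j \|* word0 (rcons (val u) false) e else 0)
      + (if (i < j)%N then KWZ i j.-1 \|* word0 (rcons (val u) true) e else 0)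
      + (if [&& val u == [::], ~~ e, i == j & (0 < i)%N]
         then KWZ i.-1 j.-1 \|* word0 [::] true else 0)
  | KUTs c k j, D0 u e =>
      (if (val u == [::]) || (val u == [:: c])
       then KUT k j \|* wordS c (val u) e else 0)
      + (if ends_in (~~ c) (val u)
         then KUTs c k (j - sgnT c) \|* word0 (rcons (val u) c) e else 0)
  | KUT k j, D1 u e =>
      (if 0 < j then KUT k (j - 1) \|* word1 (rcons (val u) true) e else 0)
      + (if j < 0 then KUT k (j + 1) \|* word1 (rcons (val u) false) e else 0)
      + (if [&& val u == [::], ~~ e, j == 0 & (0 < k)%N]
         then KUT k.-1 0 \|* word1 [::] true else 0)
  | _, _ => 0
  end.

Definition d_map : L -> L := Lext d_mon.
Definition H_map : L -> L := Lext H_mon.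

Definition iunit (e : idem) : Iring := mon e.

Definition Pi_map : L -> Iring :=
  Lext (fun a y =>
    if (a == Kone false) && (y == Done false) then iunit false
    else if (a == Kone true) && (y == Done true) then iunit true else 0).
Definition I_map : Iring -> L :=
  lext (fun e : idem => mon (Kone e) \| star (Done e)).

(* Type AA, DD and DA structures with underlying bimodule I, the operations
   being F-linear in I and hence given on i_0 and i_1. Lists of inputs are in
   order of proximity to the bimodule entry:
     m [:: a_1; ..; a_k] x [:: b_1; ..; b_n] = m_(k|1|n)(a_k,..,a_1,x,b_1,..,b_n).
   A type DD structure map is a formal sum of elementary tensors b (x) y (x) a.
   The output of a type DA structure map lies in I (x) K, resp. K^! (x) I.    *)
Definition typeAA := seq K -> idem -> seq Kd -> Iring.
Definition typeDD := idem -> seq (Kd * idem * K).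
Definition typeDA_K := seq K -> idem -> span (tbasis idem Kmon).
Definition typeDA_Kd := idem -> seq Kd -> span (tbasis Dmon idem).

Definition cotrace : typeDD := fun e =>
  if e then
    [:: (b_phip, true, a_T); (b_phim, true, a_Ti); (b_theta true, true, a_U true)]
  else
    [:: (b_w, false, a_W); (b_z, false, a_Z);
        (b_theta false, false, a_U false);
        (b_s, true, a_sigma); (b_t, true, a_tau)].

(* delta^(k,k)(e): the term ([:: b_1; ..; b_k], y', [:: a_1; ..; a_k]) stands
   for b_1 (x) .. (x) b_k (x) y' (x) a_k (x) .. (x) a_1.                      *)
Fixpoint iterDD (delta : typeDD) (k : nat) (e : idem)
  : seq (seq Kd * idem * seq K) :=
  if k is k'.+1 then
    [seq (rcons t.1.1 s.1.1, s.1.2, rcons t.2 s.2)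
       | t <- iterDD delta k' e, s <- delta t.1.2]
  else [:: ([::], e, [::])].

(* The factors alpha of a composition Pi alpha H alpha .. H alpha I.          *)
Inductive step := Step0 | StepL of K | StepR of Kd.

Definition step_code (s : step) : option (K + Kd) :=
  match s with
  | Step0 => None | StepL a => Some (inl a) | StepR b => Some (inr b)
  end.
Definition step_decode (s : option (K + Kd)) : step :=
  match s with
  | None => Step0 | Some (inl a) => StepL a | Some (inr b) => StepR b
  end.
Fact step_codeK : cancel step_code step_decode.
Proof. by case. Qed.
HB.instance Definition _ := Choice.copy step (can_type step_codeK).

Definition alpha (s : step) (v : L) : L :=
  match s with
  | Step0 => m010 v + d_map v
  | StepL a => m110 a v
  | StepR b => m011 v b
  end.

(* The first step of the list is applied first.                               *)
Definition composition (ss : seq step) (x : Iring) : Iring :=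
  if ss is s :: ss'
  then Pi_map (foldl (fun v s' => alpha s' (H_map v)) (alpha s (I_map x)) ss')
  else 0.

Definition lefts (ss : seq step) : seq K :=
  pmap (fun s => if s is StepL a then Some a else None) ss.
Definition rights (ss : seq step) : seq Kd :=
  pmap (fun s => if s is StepR b then Some b else None) ss.

Definition trace_index (aa : seq K) (bb : seq Kd) : set (seq step) :=
  [set ss | [/\ ss != [::], lefts ss = aa & rights ss = bb]].

Definition trace_term (x : idem) (ss : seq step) : Iring :=
  composition ss (iunit x).

(* [\sum_(i \in A)] stands for 0 when infinitely many summands are nonzero, so
   the finiteness of the supports has to be asserted separately.              *)
Definition trace_finite (aa : seq K) (x : idem) (bb : seq Kd) : Prop :=
  finite_set [set ss | trace_index aa bb ss /\ trace_term x ss != 0].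

Definition trace : typeAA := fun aa x bb =>
  \sum_(ss \in trace_index aa bb) trace_term x ss.

(* Tensor products of the underlying bimodules I (x) I = I are written as
   products in the ring I; x stands for x (x) x.                              *)
Definition box_AADD_term (m : typeAA) (aa : seq K) (x : idem)
    (t : seq Kd * idem * seq K) : span (tbasis idem Kmon) :=
  tens (m aa x t.1.1 * iunit t.1.2) (\prod_(c <- rev t.2) c).

Definition box_AADD (m : typeAA) (delta : typeDD) : typeDA_K := fun aa x =>
  \sum_(k \in [set: nat]) \sum_(t <- iterDD delta k x) box_AADD_term m aa x t.

Definition box_DDAA_term (m : typeAA) (x : idem) (bb : seq Kd)
    (t : seq Kd * idem * seq K) : span (tbasis Dmon idem) :=
  tens (\prod_(b <- t.1.1) b) (iunit t.1.2 * m t.2 x bb).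

Definition box_DDAA (delta : typeDD) (m : typeAA) : typeDA_Kd := fun x bb =>
  \sum_(k \in [set: nat]) \sum_(t <- iterDD delta k x) box_DDAA_term m x bb t.

Definition box_finite (delta : typeDD) (x : idem) (V : zmodType)
    (F : seq Kd * idem * seq K -> V) : Prop :=
  finite_set [set k : nat | exists2 t, t \in iterDD delta k x & F t != 0].

(* delta^1_2(a, i_e) = 1 (x) a i_e and delta^1_2(i_e, b) = i_e b (x) 1.       *)
Definition id_K : typeDA_K := fun aa x =>
  if aa is [:: a] then tens (1 : Iring) (a * mon (Kone x)) else 0.
Definition id_Kd : typeDA_Kd := fun x bb =>
  if bb is [:: b] then tens (mon (Done x) * b) (1 : Iring) else 0.

(* Main.v *)
Require Import Defs.
From HB Require Import structures.
From mathcomp Require Import all_boot all_order all_algebra finmap zify.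
From mathcomp.multinomials Require Import monalg.
From mathcomp.classical Require Import classical_sets cardinality fsbigop.

(* Write 1|y^* for the element of L with coefficient 1 in the relevant R_e, and
   call the eight terms b (x) a of the cotrace its generators. Write alpha for
   m_(0|1|0) + d.
     - After H, the terms of m_(0|1|0) that delete the last letter of a word
   cancel against d, and what remains is killed by (H alpha)^2; hence only
   finitely many compositions with given inputs are nonzero.
     - Pi only sees the coefficient of 1^*. After H this coefficient vanishes,
   and it still vanishes after a further alpha or left multiplication. So when
   the right inputs are generators, only the compositions that use a single left
   input a, and use it first, contribute. They peel generators off a, and every
   monomial of K can be peeled down to 1 in exactly one way.
     - When the left inputs are generators with matching elements of nonzero
   product in K^!, the states reached after H are 0 or 1|y^*, where y is that
   product. From 1|y^*, a right input or alpha leads to an element of the kernel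
   of H, and alpha does not contribute to Pi; so there is exactly one right
   input, used last. Every monomial y arises from exactly one sequence of
   generators. *)

Set Implicit Arguments.
Unset Strict Implicit.
Unset Printing Implicit Defensive.

Import Defs Order.TTheory GRing.Theory Num.Theory.
Local Open Scope ring_scope.

(** * Linear maps over F_2 and tensor products, compared on monomials *)

Definition flin (U V : lmodType 'F_2) (f : U -> V) : Prop :=
  forall c u v, f (c *: u + v) = c *: f u + f v.

Section Flin.
Variables U V W : lmodType 'F_2.
Implicit Types (f : U -> V) (g : V -> W).

Lemma flinD f : flin f -> {morph f : u v / u + v}.
Proof. by move=> h u v; rewrite -[u]scale1r h !scale1r. Qed.
Lemma flin0 f : flin f -> f 0 = 0.
Proof. by move=> h; apply: (addrI (f 0)); rewrite -flinD // !addr0. Qed.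
Lemma flinZ f : flin f -> forall c u, f (c *: u) = c *: f u.
Proof. by move=> h c u; rewrite -[c *: u]addr0 h flin0 // addr0. Qed.
Lemma flin_comp g f : flin g -> flin f -> flin (fun u => g (f u)).
Proof. by move=> hg hf c u v; rewrite hf hg. Qed.
Lemma flin_add f f' : flin f -> flin f' -> flin (fun u => f u + f' u).
Proof. by move=> h h' c u v; rewrite h h' scalerDr addrACA. Qed.
Lemma flin_cst0 : flin (fun _ : U => 0 : V).
Proof. by move=> c u v; rewrite scaler0 addr0. Qed.
End Flin.

Lemma flin_id (U : lmodType 'F_2) : flin (fun u : U => u).
Proof. by []. Qed.

Lemma flin_lext (B : ibasisType) (V : lmodType 'F_2) (f : B -> V) : flin (lext f).
Proof. by move=> c u v; rewrite lextD lextZ. Qed.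

Lemma flin_mull (B : pmonType) (a : span B) : flin (fun u => a * u).
Proof. by move=> c u v; rewrite mulrDr scalerAr. Qed.
Lemma flin_mulr (B : pmonType) (a : span B) : flin (fun u => u * a).
Proof. by move=> c u v; rewrite mulrDl scalerAl. Qed.

Lemma span_ext (B : ibasisType) (V : lmodType 'F_2) (f g : span B -> V) :
  flin f -> flin g -> (forall b, f (mon b) = g (mon b)) -> f =1 g.
Proof.
move=> hf hg e u; elim/span_ind: u => [|c u v IHu IHv|b]; last exact: e.
  by rewrite !flin0.
by rewrite hf hg IHu IHv.
Qed.

Lemma addF2 (V : lmodType 'F_2) (v : V) : v + v = 0.
Proof.
have -> : v + v = (1 + 1 : 'F_2) *: v by rewrite scalerDl scale1r.
by rewrite (_ : 1 + 1 = 0) ?scale0r //; apply/val_inj.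
Qed.

Section Tens.
Variables A B : ibasisType.
Lemma tens_flinl (v : span B) : flin (fun u : span A => tens u v).
Proof. exact: flin_lext. Qed.
Lemma tens_flinr (u : span A) : flin (fun v : span B => tens u v).
Proof.
move=> c v w; rewrite /tens; etransitivity; last exact: lext_lin.
by apply: eq_lext => a; rewrite lextD lextZ.
Qed.
Lemma tens0l (v : span B) : tens (0 : span A) v = 0.
Proof. exact: flin0 (tens_flinl v). Qed.
Lemma tens0r (u : span A) : tens u (0 : span B) = 0.
Proof. exact: flin0 (tens_flinr u). Qed.
Lemma tens_mon_neq (a : A) (b : B) : ridem a != lidem b -> tens (mon a) (mon b) = 0.
Proof. by move=> h; rewrite tens_monE /tens_mon insubN. Qed.
Lemma tens_val (p : tbasis A B) : tens (mon (val p).1) (mon (val p).2) = mon p.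
Proof. by rewrite tens_monE /tens_mon -surjective_pairing valK. Qed.
End Tens.

Section Lbasis.
Variable V : lmodType 'F_2.

Lemma Lext_tens (f : Kmon -> Dmon -> V) a (y : Dmon) : ridem a = ridem y ->
  Lext f (mon a \| star y) = f a y.
Proof.
move=> h; rewrite tens_monE /tens_mon; case: insubP => [p _ hp|];
  last by rewrite h eqxx.
by rewrite /= /Lext lext_mon -[sval p]/(val p) hp.
Qed.

Lemma L_ext (f g : L -> V) : flin f -> flin g ->
  (forall a y, ridem a = ridem y -> f (mon a \| star y) = g (mon a \| star y)) ->
  f =1 g.
Proof.
move=> hf hg e; apply: span_ext => // p; rewrite -tens_val.
by apply: e; apply/eqP; exact: valP p.
Qed.
End Lbasis.

(** These are the idempotents (0,0), (1,1) and (1,0) in the definition of d and H; the last splits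
    according to whether s, t stand to the right of the bar or sigma, tau to its left. *)
Lemma idem_cases (P : Kmon -> Dmon -> Prop) :
  (forall i j u e, P (KWZ i j) (D0 u e)) ->
  (forall k j u e, P (KUT k j) (D1 u e)) ->
  (forall k j c p e, P (KUT k j) (DS c p e)) ->
  (forall c k j u e, P (KUTs c k j) (D0 u e)) ->
  forall a y, ridem a = ridem y -> P a y.
Proof. by move=> h00 h11 h1S hS0 [i j|k j|c k j] [u e|u e|d p e] //= _. Qed.

Lemma flin_Lext (V : lmodType 'F_2) (f : Kmon -> Dmon -> V) : flin (Lext f).
Proof. exact: flin_lext. Qed.
Lemma H_flin : flin H_map. Proof. exact: flin_Lext. Qed.
Lemma d_flin : flin d_map. Proof. exact: flin_Lext. Qed.
Lemma m010_flin : flin m010. Proof. exact: flin_Lext. Qed.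
Lemma m110_flin a : flin (m110 a). Proof. exact: flin_Lext. Qed.
Lemma m011_flin b : flin (m011^~ b).
Proof. by move=> c u v; rewrite /m011 flin_Lext. Qed.
Lemma alpha_flin s : flin (alpha s).
Proof.
case: s => [|a|b]; [|exact: m110_flin|exact: m011_flin].
exact: flin_add m010_flin d_flin.
Qed.

(** Where the idempotents of [a] and of a dual monomial do not match, both sides vanish, because
    left multiplication preserves the right idempotent. *)
Lemma m110_tens a' a xi : m110 a' (mon a \| xi) = (a' * mon a) \| xi.
Proof.
apply: (span_ext (f := fun xi => m110 a' (mon a \| xi))) => [||y].
- exact: flin_comp (m110_flin _) (tens_flinr _).
- exact: tens_flinr.
have [h|h] := eqVneq (ridem a) (ridem (y : Dmon)); first exact: Lext_tens.
rewrite tens_mon_neq // (flin0 (m110_flin _)).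
elim/span_ind: a' => [|c u v IHu IHv|b]; first by rewrite mul0r tens0l.
  by rewrite mulrDl -scalerAl tens_flinl -IHu -IHv scaler0 addr0.
rewrite mul_mon; case E: (pmul b a) => [d|] /=; last by rewrite tens0l.
by have [_ _ hd] := pmul_idem _ _ _ E; rewrite tens_mon_neq // hd.
Qed.

(** * The operations of L on monomials *)

(* The terms of the cotrace: [Glet0] gives w (x) W and z (x) Z, [Gtheta] gives
   theta (x) U, [Gbridge] gives s (x) sigma and t (x) tau, and [Glet1] gives
   phi_+- (x) T^+-1, with the conventions of [Dmon] for the booleans. *)
Variant gen := Glet0 of bool | Gtheta of idem | Gbridge of bool | Glet1 of bool.

Definition altnil : altword := Sub [::] isT.
Definition altletter (l : bool) : altword := Sub [:: l] isT.

Definition gen_b (g : gen) : Dmon :=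
  match g with
  | Glet0 l => D0 (altletter l) false
  | Gtheta e => if e then D1 altnil true else D0 altnil true
  | Gbridge c => DS c false false
  | Glet1 l => D1 (altletter l) false
  end.
Definition gen_c (g : gen) : Kmon :=
  match g with
  | Glet0 l => if l then KWZ 0 1 else KWZ 1 0
  | Gtheta e => if e then KUT 1 0 else KWZ 1 1
  | Gbridge c => KUTs c 0 0
  | Glet1 l => KUT 0 (sgnT l)
  end.

Definition all_gens : seq gen :=
  [:: Glet0 false; Glet0 true; Gbridge true; Gbridge false; Glet1 true; Glet1 false;
      Gtheta false; Gtheta true].

Lemma m010_terms_gen : m010_terms = [seq (mon (gen_b g), mon (gen_c g)) |
  g <- all_gens].
Proof.
rewrite /m010_terms /all_gens /= /b_w /b_z /b_s /b_t /b_phip /b_phim /b_theta.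
rewrite /bword0 /bword1 /bwordS.
rewrite -[[:: false]]/(val (altletter false)) -[[:: true]]/(val (altletter true)).
by rewrite -![[::]]/(val altnil) !word0E !word1E.
Qed.

(** The right quotient of [y] by b_g. Several [g] may divide the same [y]: theta commutes with
    everything, and zs = s phi_+ ends both in s and in phi_+ (likewise wt = t phi_-). *)
Definition gen_quot (y : Dmon) (g : gen) : option Dmon :=
  match g, y with
  | Glet0 l, D0 u e =>
      if unrcons (val u) is Some (v, l') then if l' == l then word0 v e else None
      else None
  | Glet1 l, D1 u e =>
      if unrcons (val u) is Some (v, l') then if l' == l then word1 v e else None
      else None
  | Glet1 l, DS c true e => if l == c then Some (DS c false e) else None
  | Gtheta false, D0 u true => Some (D0 u false)
  | Gtheta true, D1 u true => Some (D1 u false)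
  | Gtheta true, DS c p true => Some (DS c p false)
  | Gbridge c, DS c' p e => if c == c' then word0 (nseq p c) e else None
  | _, _ => None
  end.

Variant unrcons_spec (u : seq bool) : option (seq bool * bool) -> Type :=
  | UnrconsNil : u = [::] -> unrcons_spec u None
  | UnrconsRcons v l : u = rcons v l -> unrcons_spec u (Some (v, l)).
Lemma unrconsP u : unrcons_spec u (unrcons u).
Proof.
case/lastP: u => [|v l]; first by constructor.
by rewrite unrcons_rcons; constructor.
Qed.

Lemma word0_eq v e (u : altword) f :
  (word0 v e == Some (D0 u f)) = (v == val u) && (e == f).
Proof.
apply/eqP/andP => [|[/eqP -> /eqP ->]]; last exact: word0E.
by rewrite /word0; case: insubP => //= w _ <- [-> ->].
Qed.
Lemma word1_eq v e (u : altword) f :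
  (word1 v e == Some (D1 u f)) = (v == val u) && (e == f).
Proof.
apply/eqP/andP => [|[/eqP -> /eqP ->]]; last exact: word1E.
by rewrite /word1; case: insubP => //= w _ <- [-> ->].
Qed.
Lemma word0_eqF v e y : (if y is D0 _ _ then false else true) ->
  (word0 v e == Some y) = false.
Proof. by rewrite /word0; case: insub => //= u; case: y. Qed.
Lemma word1_eqF v e y : (if y is D1 _ _ then false else true) ->
  (word1 v e == Some y) = false.
Proof. by rewrite /word1; case: insub => //= u; case: y. Qed.

Lemma D0_eq u e v f : (Some (D0 u e) == Some (D0 v f)) = (val u == val v) && (e == f).
Proof. by apply/eqP/andP => [[-> ->]|[/eqP/val_inj -> /eqP ->]]. Qed.
Lemma D1_eq u e v f : (Some (D1 u e) == Some (D1 v f)) = (val u == val v) && (e == f).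
Proof. by apply/eqP/andP => [[-> ->]|[/eqP/val_inj -> /eqP ->]]. Qed.
Lemma DS_eq c p e c' p' e' :
  (Some (DS c p e) == Some (DS c' p' e')) = [&& c == c', p == p' & e == e'].
Proof. by apply/eqP/and3P => [[-> -> ->]|[/eqP -> /eqP -> /eqP ->]]. Qed.
Lemma wordS_eq c v e c' p f :
  (wordS c v e == Some (DS c' p f)) = [&& c == c', v == nseq p c' & e == f].
Proof.
rewrite /wordS; have [->|nv] := eqVneq v [::].
  by rewrite DS_eq; case: p.
have [->|nv'] := eqVneq v [:: c].
  by rewrite DS_eq; case: p; case: (eqVneq c c') => [->|] //=; rewrite eqxx.
apply/esym/negP => /and3P[/eqP cc' /eqP vE _].
by case: p vE nv nv' => /= ->; rewrite -?cc' ?eqxx.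
Qed.
Lemma wordS_eqF c v e y : (if y is DS _ _ _ then false else true) ->
  (wordS c v e == Some y) = false.
Proof. by case: wordSP => // p; case: y. Qed.

Lemma if_Some (T : eqType) (b : bool) (o : option T) (x : T) :
  ((if b then o else None) == Some x) = b && (o == Some x).
Proof. by case: b. Qed.
Lemma if_SomeN (T : eqType) (b : bool) (o : option T) (x : T) :
  ((if b then None else o) == Some x) = ~~ b && (o == Some x).
Proof. by case: b. Qed.

(** Besides existence this contains uniqueness of the quotient, which makes the left action of b_g
    on y^* a single dual monomial or 0. *)
Lemma gen_quotP x y g : (Dmul x (gen_b g) == Some y) = (gen_quot y g == Some x).
Proof.
case: g => [l|[]|c|l]; case: x => [u e|u e|d p e] //=;
  case: y => [v f|v f|d' p' f] //=; rewrite ?andbF ?orbF ?andbT ?orbT;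
  rewrite ?cats0 ?cats1 ?if_Some ?if_SomeN ?word0_eq ?word1_eq ?wordS_eq ?D0_eq
    ?D1_eq ?DS_eq.
all: try case: unrconsP => [vE|w l' vE]; rewrite ?if_Some ?word0_eq ?word1_eq ?vE //.
all: do ?[rewrite word0_eqF // | rewrite word1_eqF // | rewrite wordS_eqF //].
all: rewrite ?andbF //.
- by rewrite -[\val v]/(sval v) vE; case: (sval u).
- rewrite -[\val v]/(sval v) vE eqseq_rcons [w == _]eq_sym [l' == _]eq_sym [f ==
  _]eq_sym.
  by rewrite -andbA andbCA.
- by case: u v e f => u ua [v va] [] [] /=; rewrite ?andbF ?andbT // eq_sym.
- rewrite [d' == _]eq_sym [p' == _]eq_sym.
  have [->|] := eqVneq d d'; last by rewrite !andbF.
  by case: e f p p' => [] [] [] []; rewrite ?andbF //= eqxx.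
- by case: u v e f => u ua [v va] [] [] /=; rewrite ?andbF ?andbT // eq_sym.
- by have [->|//] := eqVneq c d'; rewrite [nseq _ _ == _]eq_sym [f == _]eq_sym.
- by rewrite -[\val v]/(sval v) vE; case: (sval u).
- rewrite -[\val v]/(sval v) vE eqseq_rcons [w == _]eq_sym [l' == _]eq_sym [f ==
  _]eq_sym.
  by rewrite -andbA andbCA.
- rewrite [d' == _]eq_sym [f == _]eq_sym; have [->|] := eqVneq d d';
  last by rewrite !andbF.
  by case: p p' => [] [] //=; rewrite ?eqseq_cons ?andbT ?andbF.
Qed.

Lemma dual_mull_gen y g : dual_mull (mon (gen_b g)) y = ostar (gen_quot y g).
Proof.
apply: spanP => x; rewrite dual_mullE mul_mon.
rewrite -[pmul x _]/(Dmul x (gen_b g)); have := gen_quotP x y g.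
case: (Dmul x (gen_b g)) => [z|] /=; case: (gen_quot y g) => [t|] /=;
  rewrite ?coef0 ?coef_mon //=.
- by move=> h; congr ((nat_of_bool _)%:R); exact: h.
- by move=> h; rewrite (_ : (z == y) = false) //; exact: h.
- by move=> h; rewrite (_ : (t == x :> dual Dmon) = false) //; apply/esym; exact: h.
Qed.

(** Dual to mu_1(u theta) = uwz + uzw: an alternating word loses its last two letters, whichever
    they are, and gains a theta. *)
Definition mu1_quot (y : Dmon) : option Dmon :=
  if y is D0 u false then
    if unrcons (val u) is Some (v, _) then
      if unrcons v is Some (v', _) then word0 v' true else None
    else None
  else None.

Lemma alternating_rcons2 v a b :
  alternating (rcons (rcons v a) b) = alternating (rcons v a) && (a != b).
Proof.
rewrite /alternating; case: v => [|c v] /=; first by rewrite andbT.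
by rewrite rcons_path last_rcons.
Qed.
Lemma alternating_rcons v a : alternating (rcons v a) -> alternating v.
Proof. by rewrite -cats1 => /alternating_cat []. Qed.

Lemma dual_mu1_mon y : dual_mu1 y = ostar (mu1_quot y).
Proof.
apply: spanP => x; rewrite dual_mu1E /mu1 lext_mon.
have oE (o : option Dmon) : (omon o : Kd)@_y = (o == Some y)%:R.
  by case: o => [z|] /=; rewrite ?coef0 ?coef_mon.
have -> (o : option Dmon) : (ostar o)@_x = (o == Some x)%:R.
  by case: o => [z|] /=; rewrite ?coef0 ?coef_mon.
have r0 z : (if z is D0 _ true then false else true) -> (mu1_quot y == Some z) = false.
  rewrite /mu1_quot; case: y {oE} => [v [|]|v f|d q f] //.
  case: unrconsP => // w l _; case: unrconsP => // w' l' _.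
  case: z => [u [|]|u e|c p e] // _; rewrite ?word0_eq ?andbF //; exact: word0_eqF.
case: x => [u [|]|u e|c p [|]]; rewrite ?[mu1_mon _]/= ?coef0; try by rewrite r0.
  (* At most one letter can precede s or t, so wz + zw annihilates I_0 K^! I_1. *)
  2: { rewrite mon_DS mulrDl !bword00 !bword0S /bwordS /wordS /= !eqseq_cons !andbF.
       by rewrite r0 // addr0 coef0. }
rewrite mon_D0 mulrDr !bword00 /= coefD !oE.
(* A monomial cannot equal both uwz and uzw, so the sum of the two coefficients is their
   disjunction. *)
have bsum (b c d : bool) : b && c = false -> b || c = d -> b%:R + c%:R = d%:R :> 'F_2.
  by case: b c => [] [] // _ <-; rewrite /= ?addr0 ?add0r.
case: y {oE r0} => [[v va] f|v f|d q f]; last 2 first.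
- by apply: bsum; rewrite !word0_eqF.
- by apply: bsum; rewrite !word0_eqF.
case: u => u ua; rewrite !word0_eq /=; case: f; first by apply: bsum; rewrite ?andbF.
rewrite !andbT /=; apply: bsum.
  by apply/negP => /andP[/eqP <-]; rewrite eqseq_cat // eqxx.
case: unrconsP => [->|w l wE]; first by case: u ua.
case: unrconsP => [E|w' l' E]; first by rewrite wE E; case: u ua => [|? []] *;
  rewrite /= ?eqseq_cons ?andbF.
rewrite (word0_eq w' _ (Sub u ua)) andbT wE E /= in va *; move: va.
rewrite alternating_rcons2 => /andP[_].
have E2 a b : u ++ [:: a; b] = rcons (rcons u a) b by rewrite -!cats1 -catA.
rewrite !E2 !eqseq_rcons [w' == u]eq_sym.
by case: l' {E} l {wE} => [] [] // _; rewrite ?andbT ?andbF ?orbF.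
Qed.

Definition tens_option (a : option Kmon) (y : option Dmon) : L :=
  (if a is Some b then b \|* y else 0).
Lemma tens_optionE a y : omon a \| ostar y = tens_option a y.
Proof. by case: a => //=; rewrite tens0l. Qed.

Lemma m010_mon a y : ridem a = ridem y ->
  m010 (mon a \| star y) = a \|* mu1_quot y +
    \sum_(g <- all_gens) tens_option (Kmul a (gen_c g)) (gen_quot y g).
Proof.
move=> h; rewrite /m010 Lext_tens // dual_mu1_mon m010_terms_gen big_map; congr (_ + _).
by apply: eq_bigr => g _; rewrite dual_mull_gen -tens_optionE /= mul_mon.
Qed.

Lemma alpha0_mon a y : ridem a = ridem y ->
  alpha Step0 (a \|* Some y) = a \|* mu1_quot y +
    \sum_(g <- all_gens) tens_option (Kmul a (gen_c g)) (gen_quot y g) + d_mon a y.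
Proof. by move=> h; rewrite /= /d_map (Lext_tens d_mon h) m010_mon. Qed.

Lemma H_tens a y : ridem a = ridem y -> H_map (a \|* Some y) = H_mon a y.
Proof. exact: Lext_tens. Qed.

Lemma ostarN a : a \|* None = 0. Proof. exact: tens0r. Qed.

Lemma alpha0_00 i j u e : alpha Step0 (KWZ i j \|* Some (D0 u e)) =
  KWZ i j \|* mu1_quot (D0 u e) +
  (KWZ i.+1 j \|* gen_quot (D0 u e) (Glet0 false) +
   KWZ i j.+1 \|* gen_quot (D0 u e) (Glet0 true) +
   KWZ i.+1 j.+1 \|* gen_quot (D0 u e) (Gtheta false)) + d_mon (KWZ i j) (D0 u e).
Proof.
rewrite alpha0_mon // /all_gens !big_cons big_nil /tens_option; cbn [Kmul gen_c].
by rewrite !addn0 !addn1 !add0r addr0 !addrA.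
Qed.
(** The exponents [k + c] and [k + ~~ c] record that moving sigma past W, or tau past Z, produces a
    factor U, while sigma past Z and tau past W do not. *)
Lemma alpha0_S0 c k j u e : alpha Step0 (KUTs c k j \|* Some (D0 u e)) =
  KUTs c k j \|* mu1_quot (D0 u e) +
  (KUTs c (k + c) (j - 1) \|* gen_quot (D0 u e) (Glet0 false) +
   KUTs c (k + ~~ c) (j + 1) \|* gen_quot (D0 u e) (Glet0 true) +
   KUTs c k.+1 j \|* gen_quot (D0 u e) (Gtheta false)) + d_mon (KUTs c k j) (D0 u e).
Proof.
rewrite alpha0_mon // /all_gens !big_cons big_nil /tens_option; cbn [Kmul gen_c].
have -> : j - Posz 0 + Posz 1 = j + 1 by rewrite [j - Posz 0]subr0.
have -> : j - Posz 1 + Posz 0 = j - 1 by rewrite [LHS]addr0.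
have -> : j - Posz 1 + Posz 1 = j by rewrite subrK.
by rewrite !add0r addr0 !addrA; case: c; rewrite /= ?addn0 ?addn1.
Qed.
Lemma alpha0_11 k j u e : alpha Step0 (KUT k j \|* Some (D1 u e)) =
  KUT k (j + 1) \|* gen_quot (D1 u e) (Glet1 true) +
  KUT k (j - 1) \|* gen_quot (D1 u e) (Glet1 false) +
  KUT k.+1 j \|* gen_quot (D1 u e) (Gtheta true) + d_mon (KUT k j) (D1 u e).
Proof.
rewrite alpha0_mon // /all_gens !big_cons big_nil /tens_option; cbn [Kmul gen_c];
  rewrite !ostarN.
by rewrite [j + 0%:Z]addr0 !add0r addr0 !addn0 addn1 !addrA.
Qed.
Lemma alpha0_1S k j c p e : alpha Step0 (KUT k j \|* Some (DS c p e)) =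
  KUTs true k j \|* gen_quot (DS c p e) (Gbridge true) +
  KUTs false k j \|* gen_quot (DS c p e) (Gbridge false) +
  KUT k (j + 1) \|* gen_quot (DS c p e) (Glet1 true) +
  KUT k (j - 1) \|* gen_quot (DS c p e) (Glet1 false) +
  KUT k.+1 j \|* gen_quot (DS c p e) (Gtheta true) + d_mon (KUT k j) (DS c p e).
Proof.
rewrite alpha0_mon // /all_gens !big_cons big_nil /tens_option; cbn [Kmul gen_c];
  rewrite !ostarN.
by rewrite [j + 0%:Z]addr0 !add0r addr0 !addn0 addn1 !addrA.
Qed.

(** * Nilpotency of H alpha on the image of H *)

Definition Hstep0 (v : L) : L := H_map (alpha Step0 v).
Lemma Hstep0_flin : flin Hstep0. Proof. exact: flin_comp H_flin (alpha_flin _). Qed.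
Lemma Hstep0_0 : Hstep0 0 = 0. Proof. exact: flin0 Hstep0_flin. Qed.
Lemma H_map0 : H_map 0 = 0. Proof. exact: flin0 H_flin. Qed.

Lemma word0_Some u e (ua : alternating u) : word0 u e = Some (D0 (Sub u ua) e).
Proof. by rewrite -word0E. Qed.
Lemma word1_Some u e (ua : alternating u) : word1 u e = Some (D1 (Sub u ua) e).
Proof. by rewrite -word1E. Qed.

Lemma addvKv (v w : L) : v + w + v = w.
Proof. by rewrite addrAC addF2 add0r. Qed.

(** On U^i|theta^* the only term of m_(0|1|0) deletes theta, and since the coefficient is a power of
    U, d has the same term. *)
Lemma alpha0_word0_nil i e : alpha Step0 (KWZ i i \|* word0 [::] e) = 0.
Proof.
rewrite (word0_Some e (isT : alternating [::]))
  alpha0_00 /= !ostarN if_same ostarN !add0r.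
by rewrite eqxx andbT; case: e => /=;
  rewrite ?ostarN ?addr0 // (word0_Some false (isT : alternating [::])) addF2.
Qed.

Lemma alpha0_word1_nil k j e : alpha Step0 (KUT k j \|* word1 [::] e) = 0.
Proof.
rewrite (word1_Some e (isT : alternating [::])) alpha0_11 /= !ostarN !add0r.
by case: e => /=; rewrite ?ostarN ?addr0 // (word1_Some false (isT : alternating
  [::])) addF2.
Qed.

(** In idempotent 1 there is no mu_1, and d deletes theta as well as the last letter; the sign
    condition is the projection occurring in d, so everything cancels. *)
Lemma alpha0_word1_rcons k j v l e : (if l then 0 <= j else j <= 0) ->
  alpha Step0 (KUT k j \|* word1 (rcons v l) e) = 0.
Proof.
have [ua|nu] := boolP (alternating (rcons v l)); last first.
  by rewrite word1_None // ostarN (flin0 (alpha_flin _)).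
move=> lj; rewrite (word1_Some _ ua) alpha0_11 /= unrcons_rcons.
have -> : (if e then Some (D1 (Sub (rcons v l) ua) false) else None) =
          (if e then word1 (rcons v l) false else None).
  by rewrite (word1_Some _ ua).
case: l lj ua => lj ua; rewrite /= lj ?ostarN ?addr0 ?add0r.
  by case: e; rewrite ?ostarN ?addr0 ?addF2 // addrA addvKv addF2.
by case: e; rewrite ?ostarN ?addr0 ?addF2 // addrA addvKv addF2.
Qed.

Lemma H_word0_00 i j u e : alternating u -> H_map (KWZ i j \|* word0 u e) =
      (if (j < i)%N then KWZ i.-1 j \|* word0 (rcons u false) e else 0)
      + (if (i < j)%N then KWZ i j.-1 \|* word0 (rcons u true) e else 0)
      + (if [&& u == [::], ~~ e, i == j & (0 < i)%N]
         then KWZ i.-1 j.-1 \|* word0 [::] true else 0).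
Proof. by move=> ua; rewrite (word0_Some _ ua) H_tens. Qed.

Lemma H_word0_S0 c k j u e : alternating u -> H_map (KUTs c k j \|* word0 u e) =
      (if (u == [::]) || (u == [:: c]) then KUT k j \|* wordS c u e else 0)
      + (if ends_in (~~ c) u
         then KUTs c k (j - sgnT c) \|* word0 (rcons u c) e else 0).
Proof. by move=> ua; rewrite (word0_Some _ ua) H_tens. Qed.

Lemma word0_repeat v l e : word0 (rcons (rcons v l) l) e = None.
Proof. by rewrite word0_None // alternating_rcons2 eqxx andbF. Qed.

(** Under the inequality H could only append [l] once more, which repeats a letter. *)
Lemma H_word0_rcons i j v l e : (if l then (i <= j)%N else (j <= i)%N) ->
  H_map (KWZ i j \|* word0 (rcons v l) e) = 0.
Proof.
move=> lij; have [ua|nu] := boolP (alternating (rcons v l)); last first.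
  by rewrite word0_None // ostarN H_map0.
rewrite H_word0_00 // (_ : (rcons v l == [::]) = false); last by case: (v).
by case: l lij ua => lij ua; rewrite [in X in X + _ + _]ltnNge [in X in _ + X + _]ltnNge
  lij /= word0_repeat ostarN if_same !addr0.
Qed.

(* The letter-deleting terms cancel against d, leaving the contributions of mu_1
   and of theta; likewise in the next lemmas. *)
Lemma alpha0_word0_rcons i j v l e : alternating (rcons v l) ->
  (if l then (i <= j)%N else (j <= i)%N) ->
  alpha Step0 (KWZ i j \|* word0 (rcons v l) e) =
  KWZ i j \|* (if e then None else
    if unrcons v is Some (v', _) then word0 v' true else None) +
  KWZ i.+1 j.+1 \|* (if e then word0 (rcons v l) false else None).
Proof.
move=> ua lij.
rewrite (word0_Some _ ua) alpha0_00 /= unrcons_rcons.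
have -> : (if e then Some (D0 (Sub (rcons v l) ua) false) else None) =
          (if e then word0 (rcons v l) false else None).
  by rewrite (word0_Some _ ua).
case: l lij ua => lij ua; rewrite lij /= ostarN ?addr0 ?add0r -!addrA; congr (_ + _);
  by rewrite addrC -addrA addF2 addr0.
Qed.

(** The theta-deleting term keeps the last letter [l] and is killed by H. So is the mu_1 term,
    because dropping two letters of an alternating word restores the last letter, unless only two
    letters were present and the word becomes empty. *)
Lemma Hstep0_word0_rcons i j v l e : (if l then (i <= j)%N else (j <= i)%N) ->
  Hstep0 (KWZ i j \|* word0 (rcons v l) e) =
  if (v == [:: ~~ l]) && ~~ e then H_map (KWZ i j \|* word0 [::] true) else 0.
Proof.
move=> lij; have [ua|nu] := boolP (alternating (rcons v l)); last first.
  rewrite word0_None // ostarN Hstep0_0; case: eqP => // vE.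
  by move: nu; rewrite vE; case: (l).
have va := alternating_rcons ua.
rewrite /Hstep0 alpha0_word0_rcons //.
rewrite (flinD H_flin); case: e => /=.
  by rewrite ostarN H_map0 H_word0_rcons ?andbF ?addr0.
rewrite ostarN H_map0 addr0 andbT; case: unrconsP => [->|v' l' vE];
  first by rewrite ostarN H_map0.
have neqb (a b : bool) : a != b -> a = ~~ b by case: a b => [] [].
move: ua; rewrite vE alternating_rcons2 => /andP[va' /neqb l'E].
rewrite {l'}l'E in va' vE *; case/lastP: v' va' {vE} => [|w b]; first by rewrite eqxx.
rewrite alternating_rcons2 => /andP[_ /neqb ->]; rewrite negbK H_word0_rcons //.
by case: eqP => // /(congr1 size); rewrite !size_rcons.
Qed.

Lemma alpha0_sigma_rcons c k j v e : alternating (rcons v c) -> ends_in (~~ c) v ->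
  alpha Step0 (KUTs c k j \|* word0 (rcons v c) e) =
  KUTs c k j \|* (if e then None else
    if unrcons v is Some (v', _) then word0 v' true else None) +
  KUTs c k.+1 j \|* (if e then word0 (rcons v c) false else None).
Proof.
move=> ua en.
rewrite (word0_Some _ ua) alpha0_S0 /= unrcons_rcons.
have -> : (if e then Some (D0 (Sub (rcons v c) ua) false) else None) =
          (if e then word0 (rcons v c) false else None).
  by rewrite (word0_Some _ ua).
case: c ua en => ua en; rewrite en /= ?addn0 ostarN ?addr0 ?add0r -!addrA;
  congr (_ + _);
  by rewrite addrC -addrA addF2 addr0.
Qed.

Definition isDS (o : option Dmon) : bool :=
  match o with Some (DS _ _ _) | None => true | _ => false end.

Lemma H_KUT_isDS k j o : isDS o -> H_map (KUT k j \|* o) = 0.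
Proof. by case: o => [[u e|u e|c p e]|] // _;
  [exact: H_tens | rewrite ostarN H_map0]. Qed.

(** The words left by alpha are empty or end in [c], so H cannot append a letter to them. It can
    only trade sigma for s, or tau for t, which leads to a summand that [Hstep0] annihilates. *)
Lemma Hstep0_sigma_rcons c k j v e : ends_in (~~ c) v ->
  exists o : option Dmon, Hstep0 (KUTs c k j \|* word0 (rcons v c) e)
    = KUT k j \|* o /\ isDS o.
Proof.
rewrite /ends_in; case: unrconsP => // v' l' vE /eqP lE; rewrite {l'}lE in vE.
have [ua|nu] := boolP (alternating (rcons v c)); last first.
  by exists None; rewrite word0_None // !ostarN Hstep0_0.
have va := alternating_rcons ua.
rewrite /Hstep0 alpha0_sigma_rcons //; last by rewrite vE /ends_in unrcons_rcons eqxx.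
rewrite (flinD H_flin); case: e => /=.
  exists None; split=> //; rewrite !ostarN H_map0 add0r H_word0_S0 // /ends_in
    unrcons_rcons.
  rewrite vE -[[:: c]]/(rcons [::] c) eqseq_rcons andbC /= (_ : (c == ~~ c) = false);
    last by case: (c).
  by rewrite addr0 andbC; case: (v').
rewrite ostarN H_map0 addr0 vE unrcons_rcons.
have v'a : alternating v' by move: va; rewrite vE => /alternating_rcons.
exists (wordS c v' true); split; last by case: wordSP.
rewrite H_word0_S0 // [in X in _ + X]/ends_in.
case: unrconsP => [->|w b v'E]; first by rewrite /wordS /= addr0.
move: va; rewrite vE v'E alternating_rcons2 => /andP[_ bc].
rewrite (negPf bc) addr0 (_ : (rcons w b == [::]) = false); last by case: (w).
by case: eqP => //= ne; rewrite /wordS (_ : (rcons w b == [::]) = false)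
  ?(introF eqP ne) //;
  rewrite ?ostarN //; case: (w).
Qed.

(** The sigma and tau terms of m_(0|1|0) cancel against d; deleting phi_+- or theta does not leave
    the dual of I_0 K^! I_1. *)
Lemma alpha0_KUT_DS k j c p e : exists o1 o2 o3, [&& isDS o1, isDS o2 & isDS o3] /\
  alpha Step0 (KUT k j \|* Some (DS c p e)) =
  KUT k (j + 1) \|* o1 + KUT k (j - 1) \|* o2 + KUT k.+1 j \|* o3.
Proof.
exists (gen_quot (DS c p e) (Glet1 true)), (gen_quot (DS c p e) (Glet1 false)),
  (gen_quot (DS c p e) (Gtheta true)).
split; first by case: c p e => [] [] [].
rewrite alpha0_1S; case: c; rewrite /= ostarN ?addr0 ?add0r addrC !addrA;
  by rewrite addF2 add0r.
Qed.

Lemma Hstep0_KUT_isDS k j o : isDS o -> Hstep0 (KUT k j \|* o) = 0.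
Proof.
case: o => [[u e|u e|c p e]|] // _; last by rewrite ostarN Hstep0_0.
have [o1 [o2 [o3 [/and3P[i1 i2 i3] E]]]] := alpha0_KUT_DS k j c p e.
by rewrite /Hstep0 E !(flinD H_flin) !H_KUT_isDS // !addr0.
Qed.

(** In idempotents (1,1), alpha already kills the image of H. In (1,0), one [Hstep0] gives 0 or
    lands in the dual of I_0 K^! I_1, where the next one vanishes. In (0,0), only a two-letter word
    survives the first: it becomes theta, to which H appends at most one letter, and a one-letter
    word does not survive the second. *)
Lemma Hstep0_H_nilp v : Hstep0 (Hstep0 (H_map v)) = 0.
Proof.
have NNf : flin (fun v => Hstep0 (Hstep0 v))
  by apply: flin_comp Hstep0_flin Hstep0_flin.
have NNH : flin (fun v => Hstep0 (Hstep0 (H_map v))) by apply: flin_comp NNf H_flin.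
have ifN (b : bool) w : (b -> Hstep0 (Hstep0 w) = 0)
  -> Hstep0 (Hstep0 (if b then w else 0)) = 0.
  by case: b => [->|] //; rewrite !Hstep0_0.
move: v; apply: (L_ext (f := fun v => Hstep0 (Hstep0 (H_map v))) (g := fun=> 0)) => //.
  exact: flin_cst0.
apply: idem_cases => [i j u e|k j u e|k j c p e|c k j u e];
  rewrite -[star _]/(ostar (Some _)) H_tens //= ?(flinD NNf) ?Hstep0_0 //.
- have NNr i' j' v l e' : (if l then (i' <= j')%N else (j' <= i')%N) ->
      Hstep0 (Hstep0 (KWZ i' j' \|* word0 (rcons v l) e')) = 0.
    move=> lij; rewrite Hstep0_word0_rcons //; case: ifP => _; last exact: Hstep0_0.
    rewrite H_word0_00 //= ?andbF addr0 (flinD Hstep0_flin).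
    have [jij|jij] := ltnP j' i'; have [iji|iji] := ltnP i' j';
      rewrite ?Hstep0_0 ?addr0 ?add0r //.
    + by have := ltn_trans jij iji; rewrite ltnn.
    + rewrite (@Hstep0_word0_rcons i'.-1 j' [::] false true) //=;
      by case: i' jij {lij iji}.
    + rewrite (@Hstep0_word0_rcons i' j'.-1 [::] true true) //=;
      by case: j' iji {lij jij}.
  rewrite !ifN ?addr0 // => [/and4P[_ _ /eqP -> _]|ij|ji].
  + by rewrite [Hstep0 (_ \|* word0 [::] true)]/Hstep0 alpha0_word0_nil H_map0 Hstep0_0.
  + by apply: NNr; case: j ij.
  + by apply: NNr; case: i ji.
- rewrite !ifN ?addr0 // => [_|j0|j0];
  rewrite [Hstep0 (_ \|* _)]/Hstep0 ?alpha0_word1_nil;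
    rewrite ?alpha0_word1_rcons ?H_map0 ?Hstep0_0 //=.
  + by rewrite lezD1.
  + by rewrite subr_ge0 -gtz0_ge1.
- rewrite !ifN ?addr0 // => [en|_].
  + by have [o [-> oS]] := Hstep0_sigma_rcons k (j - sgnT c) e en;
    rewrite Hstep0_KUT_isDS.
  + by rewrite Hstep0_KUT_isDS ?Hstep0_0 //; case: wordSP.
Qed.

(** * Finiteness of the trace *)

(** Here [v] is already the result of a first alpha, so that H comes before each further one. *)
Definition chain (v : L) (ss : seq step) : L :=
  foldl (fun v s => alpha s (H_map v)) v ss.

Lemma chain0 ss : chain 0 ss = 0.
Proof. by elim: ss => //= s ss IHss; rewrite H_map0 (flin0 (alpha_flin s)). Qed.

Lemma chain_cons v s ss : chain v (s :: ss) = chain (alpha s (H_map v)) ss.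
Proof. by []. Qed.

Lemma Pi_flin : flin Pi_map. Proof. exact: flin_Lext. Qed.

Lemma composition_cons s ss x :
  composition (s :: ss) x = Pi_map (chain (alpha s (I_map x)) ss).
Proof. by []. Qed.

Lemma lefts_cons s ss :
  lefts (s :: ss) = (if s is StepL a then [:: a] else [::]) ++ lefts ss.
Proof. by case: s. Qed.
Lemma rights_cons s ss :
  rights (s :: ss) = (if s is StepR b then [:: b] else [::]) ++ rights ss.
Proof. by case: s. Qed.

(** With n inputs there are n + 1 gaps between them. Three consecutive [Step0] contain H alpha H
    alpha H and give 0 by [Hstep0_H_nilp], and 3(n + 1) steps force such a run. *)
Lemma chain_long v ss :
  (3 * (size (lefts ss) + size (rights ss)).+1 <= size ss)%N -> chain v ss = 0.
Proof.
elim: {ss}(size ss) {-2}ss (leqnn (size ss)) v => [|n IHn] [|a ss] // le v.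
case: ss le => [|b [|c r]] le //.
  by rewrite mulnS.
  by rewrite mulnS.
pose inp s := if s is Step0 then false else true.
have sz s t : (size (lefts (s :: t)) + size (rights (s :: t)) =
               inp s + (size (lefts t) + size (rights t)))%N.
  by case: s => [|x|x]; rewrite //= addnS.
rewrite !sz => h; rewrite chain_cons.
have [ia|na] := boolP (inp a).
  by apply: IHn; rewrite ?sz; move: le h; rewrite ia /=; lia.
rewrite chain_cons; have [ib|nb] := boolP (inp b).
  by apply: IHn; rewrite ?sz; move: le h; rewrite ib /=; lia.
rewrite chain_cons; have [ic|nc] := boolP (inp c).
  by apply: IHn; move: le h; rewrite ic /=; lia.
case: a b c {h le} na nb nc => // [] [] // [] // _ _ _.
by rewrite -[H_map (alpha _ (H_map (alpha _ _)))]/(Hstep0 (Hstep0 (H_map v)))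
  Hstep0_H_nilp (flin0 (alpha_flin _)) chain0.
Qed.

Fixpoint words_upto (T : Type) (alph : seq T) (n : nat) : seq (seq T) :=
  if n is n'.+1 then [::] :: [seq s :: w | s <- alph, w <- words_upto alph n']
  else [:: [::]].

Lemma mem_words_upto (T : eqType) (alph : seq T) n w :
  (size w <= n)%N -> {subset w <= alph} -> w \in words_upto alph n.
Proof.
elim: n w => [|n IHn] [|s w] //= sw sub; rewrite inE.
rewrite orbC (allpairs_f cons) //; first exact/sub/mem_head.
by apply: IHn => // t tw; apply: sub; rewrite inE tw orbT.
Qed.

Lemma step_in_inputs ss :
  {subset ss <= Step0 :: map StepL (lefts ss) ++ map StepR (rights ss)}.
Proof.
elim: ss => // s ss IHss t; rewrite inE => /predU1P[->|/IHss].
  rewrite lefts_cons rights_cons; case: s => [|a|b]; first exact: mem_head.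
    by rewrite inE mem_cat mem_head orbT.
  by rewrite inE mem_cat mem_head !orbT.
rewrite !inE !mem_cat lefts_cons rights_cons !map_cat !mem_cat.
by case/or3P => ->; rewrite ?orbT.
Qed.

(** All steps belong to the finite alphabet formed by [Step0] and the given inputs, and [chain_long]
    bounds their number. *)
Lemma chain_finite (aa : seq K) (bb : seq Kd) (v : step -> L) :
  finite_set [set ss | [/\ lefts ss = aa, rights ss = bb &
    if ss is s :: ss' then chain (v s) ss' != 0 else true]].
Proof.
pose alph := Step0 :: map StepL aa ++ map StepR bb.
(* The additional 1 accounts for the first step, which is not part of the chain. *)
pose M := (3 * (size aa + size bb).+1).+1.
apply: (sub_finite_set _ (finite_seq (words_upto alph M))) => ss /= [la rb ne].
change (is_true (ss \in words_upto alph M)); apply: mem_words_upto;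
  last by move=> t /step_in_inputs; rewrite la rb.
case: ss la rb ne => [|s ss] //; rewrite lefts_cons rights_cons => la rb.
apply: contraNT; rewrite -ltnNge => lt; apply/eqP/chain_long.
by move: lt; rewrite /M -la -rb !size_cat /=; lia.
Qed.

Lemma trace_finiteP aa x bb : trace_finite aa x bb.
Proof.
apply: sub_finite_set (chain_finite aa bb (fun s => alpha s (I_map (iunit x)))).
case=> [|s ss] [[ne0 la rb]] => [|ne]; first by rewrite eqxx in ne0.
split=> //; apply: contraNN ne => /eqP ne.
by rewrite /trace_term composition_cons ne (flin0 Pi_flin).
Qed.

(** * The trace with right inputs among the generators *)

(* [eval b] sends a|y^* to y^*(b) a, so that [eval 1] extracts the coefficient
   of 1^*. *)
Definition eval (b : Kd) : L -> K := Lext (fun a y => b@_y *: mon a).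

Lemma eval_flin b : flin (eval b). Proof. exact: flin_Lext. Qed.

Lemma coef1_Kd y : (1 : Kd)@_y = ((Done false == y) || (Done true == y))%:R.
Proof.
rewrite [1 : Kd]/(mon (Done false) + mon (Done true)) coefD !coef_mon.
by case: eqP => [<-|_] /=; rewrite ?addr0 ?add0r.
Qed.

Lemma coef_mul_Done (b : Kd) e y :
  (b * mon (Done e))@_y = if ridem y == e then b@_y else 0.
Proof.
elim/span_ind: b => [|c u v IHu IHv|x]; first by rewrite mul0r coef0 if_same.
  rewrite mulrDl -scalerAl !coefD !coefZ IHu IHv.
  by case: ifP; rewrite ?mulr0 ?addr0.
rewrite mul_mon -[Done e]/(pone e) pmulr1; have [<-|xe] := eqVneq (ridem x) e.
  rewrite /= coef_mon; have [->|_] := eqVneq x y; first by rewrite eqxx.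
  by rewrite if_same.
rewrite /= coef0; case: eqP => // ye; rewrite coef_mon; case: eqP => // xy.
by rewrite xy ye eqxx in xe.
Qed.

Lemma eval_mon b a y : ridem a = ridem y -> eval b (mon a \| star y) = b@_y *: mon a.
Proof. exact: Lext_tens. Qed.

Lemma ridem_Done e : ridem (Done e) = e. Proof. exact: (Done_idem e).2. Qed.

Lemma Done_or (y : Dmon) : (Done false == y) || (Done true == y)
  = (y == Done (ridem y)).
Proof. by case: y => [u e|u e|c p e]; rewrite /= ?orbF // eq_sym. Qed.

Lemma eval1_tens a xi : eval 1 (mon a \| xi) = xi@_(Done (ridem a)) *: mon a.
Proof.
apply: (span_ext (f := fun xi => eval 1 (mon a \| xi))
  (g := fun xi : Defs.span (dual Dmon) => xi@_(Done (ridem a)) *: mon a)) => [||y].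
- exact: flin_comp (eval_flin _) (tens_flinr _).
- by move=> c u v; rewrite (@coefD (dual Dmon)) (@coefZ (dual Dmon)) scalerDl scalerA.
rewrite (@coef_mon (dual Dmon)); have [h|h] := eqVneq (ridem a) (ridem (y : Dmon)).
  rewrite eval_mon // coef1_Kd h; congr ((nat_of_bool _)%:R *: _); exact: Done_or.
rewrite tens_mon_neq // (flin0 (eval_flin _)).
case: eqP => [yE|]; last by rewrite scale0r.
by rewrite yE ridem_Done eqxx in h.
Qed.

(** By definition (y^* b)(1) = y^*(b): a right input moves into the argument of the functional. *)
Lemma eval_m011 b v : eval 1 (m011 v b) = eval b v.
Proof.
move: v; apply: L_ext => [||a y h]; last 1 first.
- rewrite /m011 Lext_tens // eval1_tens dual_mulrE coef_mul_Done h eqxx.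
  by rewrite eval_mon.
- exact: flin_comp (eval_flin _) (m011_flin _).
- exact: eval_flin.
Qed.

Lemma eval_m110 b a v : eval b (m110 a v) = a * eval b v.
Proof.
move: v; apply: L_ext => [||a' y h]; last 1 first.
- rewrite m110_tens eval_mon // -scalerAr.
  apply: (span_ext (f := fun a : K => eval b ((a * mon a') \| star y))
    (g := fun a : K => b@_y *: (a * mon a'))) => [||d].
  + apply: flin_comp (eval_flin _) _; apply: flin_comp (tens_flinl _) _.
    exact: flin_mulr.
  + by move=> c u w; rewrite mulrDl -scalerAl scalerDr !scalerA [X in X *: _]mulrC.
  rewrite mul_mon; case E: (pmul d a') => [c|] /=.
    by rewrite eval_mon //; have [_ _ ->] := pmul_idem _ _ _ E.
  by rewrite tens0l (flin0 (eval_flin _)) scaler0.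
- exact: flin_comp (eval_flin _) (m110_flin _).
- exact: flin_comp (flin_mull _) (eval_flin _).
Qed.

(** The effect of Pi on the coefficient of 1^*. It is linear but not multiplicative, since T and
    T^-1 go to 0 while their product does not. *)
Definition eps : K -> Iring := lext (fun a : Kmon =>
  if a == Kone false then iunit false
  else if a == Kone true then iunit true else 0).
Lemma eps_flin : flin eps. Proof. exact: flin_lext. Qed.

Lemma Pi_eval v : Pi_map v = eps (eval 1 v).
Proof.
move: v; apply: L_ext => [||a y h]; last 1 first.
- rewrite /Pi_map Lext_tens // eval_mon // (flinZ eps_flin) /eps lext_mon coef1_Kd.
  rewrite ![_ == y]eq_sym; move: a y h;
    apply: idem_cases => [i j u e|k j u e|k j c p e|c k j u e] /=;
   rewrite ?scaler0 //.
  + rewrite orbF; case: (_ == Done false); rewrite ?andbT ?andbF ?scale1r ?scale0r //.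
  + by case: (_ == Done true); rewrite ?andbT ?andbF ?scale1r ?scale0r //.
  + by rewrite andbF scale0r.
- exact: Pi_flin.
- exact: flin_comp eps_flin (eval_flin _).
Qed.

Lemma eval_ostar b (a : Kmon) (o : option Dmon) :
  (if o is Some y then b@_y = 0 else True) -> eval b (a \|* o) = 0.
Proof.
case: o => [y|] h; last by rewrite ostarN (flin0 (eval_flin _)).
have [e|e] := eqVneq (ridem a) (ridem y); first by rewrite eval_mon // h scale0r.
by rewrite tens_mon_neq // (flin0 (eval_flin _)).
Qed.

Lemma eval_gen (x : Dmon) (a : Kmon) (o : option Dmon) : ridem a = ridem x ->
  eval (mon x) (a \|* o) = (o == Some x)%:R *: mon a.
Proof.
move=> ax; have [->|ox] := eqVneq o (Some x).
  by rewrite eval_mon // coef_mon eqxx.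
rewrite scale0r; apply: eval_ostar; case: o ox => // y yx; rewrite coef_mon.
by case: eqP => // xy; rewrite xy eqxx in yx.
Qed.

Definition isDone (o : option Dmon) : bool :=
  match o with
  | Some (D0 u e) | Some (D1 u e) => (val u == [::]) && ~~ e
  | _ => false
  end.

Lemma isDone_word0 v e : isDone (word0 v e) -> (v == [::]) && ~~ e.
Proof. by rewrite /word0; case: insubP => //= u _ ->. Qed.
Lemma isDone_word1 v e : isDone (word1 v e) -> (v == [::]) && ~~ e.
Proof. by rewrite /word1; case: insubP => //= u _ ->. Qed.

Lemma eval1_notDone a o : ~~ isDone o -> eval 1 (a \|* o) = 0.
Proof.
move=> no; apply: eval_ostar; case: o no => // y ny; rewrite coef1_Kd.
by case: eqP ny => [<-|_] //; case: eqP => [<-|].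
Qed.

Lemma eval1_word0 a v e : ~~ ((v == [::]) && ~~ e) -> eval 1 (a \|* word0 v e) = 0.
Proof. by move=> nv; apply: eval1_notDone; apply: contra nv; apply: isDone_word0. Qed.
Lemma eval1_word1 a v e : ~~ ((v == [::]) && ~~ e) -> eval 1 (a \|* word1 v e) = 0.
Proof. by move=> nv; apply: eval1_notDone; apply: contra nv; apply: isDone_word1. Qed.
Lemma eval1_isDS a o : isDS o -> eval 1 (a \|* o) = 0.
Proof. by move=> iS; apply: eval1_notDone; case: o iS => [[]|]. Qed.

Lemma rcons_nil (T : eqType) (v : seq T) l : (rcons v l == [::]) = false.
Proof. by case: v. Qed.

Lemma eval1_if (b : bool) w : (b -> eval 1 w = 0) -> eval 1 (if b then w else 0) = 0.
Proof. by case: b => [->|_] //; apply: flin0 (eval_flin _). Qed.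

Lemma L_ext0 (V : lmodType 'F_2) (f : L -> V) : flin f ->
  (forall a y, ridem a = ridem y -> f (mon a \| star y) = 0) -> forall v, f v = 0.
Proof. by move=> hf e; apply: L_ext => //; apply: flin_cst0. Qed.

(** Every component of H adds a letter, theta, s or t to the dual word. *)
Lemma eval1_H v : eval 1 (H_map v) = 0.
Proof.
move: v; apply: L_ext0; first exact: flin_comp (eval_flin _) H_flin.
apply: idem_cases => [i j u e|k j u e|k j c p e|c k j u e];
  rewrite -[star _]/(ostar (Some _)) H_tens //= ?(flinD (eval_flin 1));
  rewrite ?eval1_if ?(flin0 (eval_flin _)) ?addr0 // => _;
  by rewrite ?eval1_word0 ?eval1_word1 ?rcons_nil ?eval1_isDS //; case: wordSP.
Qed.

(** To reach 1^*, alpha would have to delete what H has just added, and exactly these terms cancel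
    against d. The remaining ones carry a theta or a nonempty word, or lie in the dual of I_0 K^!
    I_1. *)
Lemma eval1_alpha0_H v : eval 1 (alpha Step0 (H_map v)) = 0.
Proof.
have af := flin_comp (eval_flin 1) (alpha_flin Step0).
have ifA (b : bool) w : (b -> eval 1 (alpha Step0 w) = 0) ->
    eval 1 (alpha Step0 (if b then w else 0)) = 0.
  by case: b => [->|_] //; apply: flin0 af.
have altA (a : Kmon) (u : seq bool) e :
    (alternating u -> eval 1 (alpha Step0 (a \|* word0 u e)) = 0) ->
    eval 1 (alpha Step0 (a \|* word0 u e)) = 0.
  have [ua ->|nu _] // := boolP (alternating u).
  by rewrite word0_None // ostarN; apply: flin0 af.
have E1 (a b : Kmon) (u : seq bool) l (e : bool) :
    eval 1 (a \|* (if e then None else if unrcons u is Some (v',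
      _) then word0 v' true else None)
    + b \|* (if e then word0 (rcons u l) false else None)) = 0.
  rewrite (flinD (eval_flin 1)) !eval1_notDone ?addr0 //; case: e => //=.
    by apply/negP => /isDone_word0; rewrite rcons_nil.
  by case: unrconsP => // w l' _; apply/negP => /isDone_word0; rewrite andbF.
move: v; apply: L_ext0; first exact: flin_comp af H_flin.
apply: idem_cases => [i j u e|k j u e|k j c p e|c k j u e];
  rewrite -[star _]/(ostar (Some _)) H_tens //= ?(flinD af) ?(flin0 af) //.
- rewrite !ifA ?addr0 // => [/and4P[_ _ /eqP -> _]|ij|ji].
  + by rewrite alpha0_word0_nil (flin0 (eval_flin 1)).
  + by apply: altA => ua; rewrite alpha0_word0_rcons //; case: j ij.
  + by apply: altA => ua; rewrite alpha0_word0_rcons //; case: i ji.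
- rewrite !ifA ?addr0 // => [_|j0|j0];
  rewrite ?alpha0_word1_nil ?(flin0 (eval_flin 1)) //.
  + by rewrite alpha0_word1_rcons ?(flin0 (eval_flin 1)) //= lezD1.
  + by rewrite alpha0_word1_rcons ?(flin0 (eval_flin 1)) //= subr_ge0 -gtz0_ge1.
- rewrite !ifA ?addr0 // => [en|_].
  + by apply: altA => ua; rewrite alpha0_sigma_rcons.
  case: wordSP => [|p]; first by rewrite ostarN (flin0 af).
  have [o1 [o2 [o3 [/and3P[i1 i2 i3] ->]]]] := alpha0_KUT_DS k j c p e.
  by rewrite !(flinD (eval_flin 1)) !eval1_isDS // !addr0.
Qed.

(* The effect on the coefficient of 1^* of H followed by the right action of
   b_g: it divides by c_g on the right, but only if c_g is the generator that H
   detects. *)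
Definition peel_mon (g : gen) (a : Kmon) : option Kmon :=
  match g, a with
  | Glet0 l, KWZ i j =>
      if l then if (i < j)%N then Some (KWZ i j.-1) else None
      else if (j < i)%N then Some (KWZ i.-1 j) else None
  | Gtheta false, KWZ i j => if (i == j) && (0 < i)%N then Some (KWZ i.-1 j.-1)
    else None
  | Gbridge c, KUTs c' k j => if c == c' then Some (KUT k j) else None
  | Glet1 l, KUT k j =>
      if l then if 0 < j then Some (KUT k (j - 1)) else None
      else if j < 0 then Some (KUT k (j + 1)) else None
  | Gtheta true, KUT k j => if (j == 0) && (0 < k)%N then Some (KUT k.-1 0) else None
  | _, _ => None
  end.

Definition peel (g : gen) : K -> K := lext (fun a => omon (peel_mon g a) : K).
Lemma peel_flin g : flin (peel g). Proof. exact: flin_lext. Qed.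

Lemma eval_tens_ostar x a o :
  eval (mon x) (a \|* o) = ((ridem a == ridem x) && (o == Some x))%:R *: mon a.
Proof.
have [h|h] := eqVneq (ridem a) (ridem x); first by rewrite eval_gen.
rewrite scale0r; case: o => [y|]; last by rewrite ostarN (flin0 (eval_flin _)).
have [e|e] := eqVneq (ridem a) (ridem y); last first.
  by rewrite tens_mon_neq // (flin0 (eval_flin _)).
rewrite eval_mon // coef_mon; case: eqP => [xy|]; last by rewrite scale0r.
by rewrite e xy eqxx in h.
Qed.

Lemma coef1_D0 u e : (1 : Kd)@_(D0 u e) = ((val u == [::]) && ~~ e)%:R.
Proof.
rewrite coef1_Kd orbF; congr (nat_of_bool _)%:R.
have := D0_eq u e altnil false; rewrite eqbF_neg => <-; exact: eq_sym.
Qed.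
Lemma coef1_D1 u e : (1 : Kd)@_(D1 u e) = ((val u == [::]) && ~~ e)%:R.
Proof.
rewrite coef1_Kd /=; congr (nat_of_bool _)%:R.
have := D1_eq u e altnil false; rewrite eqbF_neg => <-; exact: eq_sym.
Qed.
Lemma coef1_DS c p e : (1 : Kd)@_(DS c p e) = 0.
Proof. by rewrite coef1_Kd. Qed.

Lemma rcons_eq1 (u : seq bool) a b : (rcons u a == [:: b]) = (u == [::]) && (a == b).
Proof. by rewrite -[[:: b]]/(rcons [::] b) eqseq_rcons. Qed.

(* Only a | 1^* is taken by H to multiples of the duals of the generators. *)
Lemma eval_gen_H g v : eval (mon (gen_b g)) (H_map v) = peel g (eval 1 v).
Proof.
have ifE b (c : bool) w : eval b (if c then w else 0) = if c then eval b w else 0.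
  by case: c => //; rewrite (flin0 (eval_flin _)).
have if0 (b : bool) : (if b then 0 : K else 0) = 0 by case: b.
move: v; apply: L_ext.
- exact: flin_comp (eval_flin _) H_flin.
- exact: flin_comp (peel_flin _) (eval_flin _).
have oK (b : bool) (a : Kmon) : omon (if b then Some a else None)
  = if b then mon a else 0 :> K.
  by case: b.
apply: idem_cases => [i j u e|k j u e|k j c p e|c k j u e];
  rewrite eval_mon // ?coef1_D0 ?coef1_D1 ?coef1_DS (flinZ (peel_flin _))
    [peel g _]lext_mon;
  rewrite -[star _]/(ostar (Some _)) H_tens // [H_mon _ _]/= ?(flinD (eval_flin _))
    ?ifE ?eval_tens_ostar.
- case: g => [l|[]|c|l]; rewrite [gen_b _]/= ?word0_eq ?word0_eqF //= ?andbF ?scale0r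
  ?if0 ?scaler0 ?addr0 //.
  + rewrite !rcons_eq1 -!andbA; case: (val u == [::]) => /=;
    rewrite ?scale0r ?if0 ?addr0 //.
    by case: l e => [] [] /=; rewrite ?scale1r ?scale0r ?if0 ?addr0 ?add0r ?oK.
  + rewrite !rcons_nil /= !scale0r !if0 !add0r scale1r oK.
    by case: (val u == [::]) e => [] [] /=; rewrite ?scale1r ?scale0r.
- case: g => [l|[]|c|l]; rewrite [gen_b _]/= ?word1_eq ?word1_eqF //= ?andbF ?scale0r
  ?if0 ?scaler0 ?addr0 //.
  + rewrite !rcons_nil /= !scale0r !if0 !add0r scale1r oK.
    by case: (val u == [::]) e => [] [] /=; rewrite ?scale1r ?scale0r.
  + rewrite !rcons_eq1 -!andbA; case: (val u == [::]) => /=;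
    rewrite ?scale0r ?if0 ?addr0 //.
    by case: l e => [] [] /=; rewrite ?scale1r ?scale0r ?if0 ?addr0 ?add0r ?oK.
- by rewrite (flin0 (eval_flin _)) scale0r.
case: g => [l|[]|c'|l]; rewrite [gen_b _]/= ?wordS_eq ?word0_eq ?word0_eqF ?wordS_eqF
  //=
  ?andbF ?scale0r ?if0 ?scaler0 ?addr0 //.
- rewrite rcons_eq1; case: eqP => [->|_]; first by rewrite /ends_in /= addr0.
  by rewrite scale0r if0 addr0.
- by rewrite rcons_nil scale0r if0 addr0.
- rewrite oK [c' == c]eq_sym; case: (val u == [::]); rewrite /= ?andbF ?scale0r ?if0 //.
  by case: (c == c') e => [] [] /=; rewrite ?scale1r ?scale0r ?scaler0.
Qed.

(** * The iterates of the cotrace as paths of generators *)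

Definition gens (e : idem) : seq gen :=
  if e then [:: Glet1 true; Glet1 false; Gtheta true]
  else [:: Glet0 false; Glet0 true; Gtheta false; Gbridge true; Gbridge false].
Definition gen_tgt (g : gen) : idem :=
  match g with Glet0 _ => false | Gtheta e => e | Gbridge _ | Glet1 _ => true end.

Definition path_tgt (e : idem) (p : seq gen) : idem := last e (map gen_tgt p).
Definition path_b (p : seq gen) : seq Kd := [seq mon (gen_b g) | g <- p].
Definition path_c (p : seq gen) : seq K := [seq mon (gen_c g) | g <- p].

(** The generators are read as edges of a graph on {i_0, i_1}; its paths index the terms of
    delta^(k,k). *)
Fixpoint paths (k : nat) (e : idem) : seq (seq gen) :=
  if k is k'.+1 then [seq rcons p g | p <- paths k' e, g <- gens (path_tgt e p)]
  else [:: [::]].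

Lemma cotraceE e : cotrace e = [seq (mon (gen_b g), gen_tgt g,
  mon (gen_c g)) | g <- gens e].
Proof.
rewrite /cotrace /b_w /b_z /b_s /b_t /b_phip /b_phim /b_theta.
rewrite /bword0 /bword1 /bwordS.
rewrite -[[:: false]]/(val (altletter false)) -[[:: true]]/(val (altletter true)).
by rewrite -![[::]]/(val altnil) !word0E !word1E; case: e.
Qed.

Definition gen_code (g : gen) : bool * bool * bool :=
  match g with
  | Glet0 l => (false, false, l) | Gtheta e => (false, true, e)
  | Gbridge c => (true, false, c) | Glet1 l => (true, true, l)
  end.
Definition gen_decode (x : bool * bool * bool) : gen :=
  match x with
  | (false, false, l) => Glet0 l | (false, true, e) => Gtheta e
  | (true, false, c) => Gbridge c | (true, true, l) => Glet1 l
  end.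
Fact gen_codeK : cancel gen_code gen_decode. Proof. by case. Qed.
HB.instance Definition _ := Choice.copy gen (can_type gen_codeK).

Lemma path_tgt_rcons e p g : path_tgt e (rcons p g) = gen_tgt g.
Proof. by rewrite /path_tgt map_rcons last_rcons. Qed.

Lemma iterDD_cotrace k e :
  iterDD cotrace k e = [seq (path_b p, path_tgt e p, path_c p) | p <- paths k e].
Proof.
elim: k => //= k ->; rewrite allpairs_mapl map_allpairs.
congr flatten; apply: eq_map => p /=; rewrite cotraceE -map_comp.
by apply: eq_map => g /=; rewrite path_tgt_rcons /path_b /path_c !map_rcons.
Qed.

Lemma size_paths k e p : p \in paths k e -> size p = k.
Proof.
elim: k p => [|k IHk] p /=; first by rewrite inE => /eqP ->.
by case/allpairsPdep => q [g [/IHk <- _ ->]]; rewrite size_rcons.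
Qed.

Lemma sum_pathsSr (V : zmodType) (F : seq gen -> V) k e :
  \sum_(p <- paths k.+1 e) F p =
  \sum_(p <- paths k e) \sum_(g <- gens (path_tgt e p)) F (rcons p g).
Proof. by rewrite /= big_allpairs_dep. Qed.

(** Paths grow at their end, like [iterDD], whereas peeling consumes them from the front. *)
Lemma sum_pathsS (V : zmodType) (F : seq gen -> V) k e :
  \sum_(p <- paths k.+1 e) F p =
  \sum_(g <- gens e) \sum_(p <- paths k (gen_tgt g)) F (g :: p).
Proof.
elim: k F => [|k IHk] F.
  by rewrite sum_pathsSr big_seq1; apply: eq_bigr => g _; rewrite big_seq1.
rewrite sum_pathsSr IHk; apply: eq_bigr => g _.
by rewrite sum_pathsSr.
Qed.

(** Each monomial contributes for a single [k], its length, and only the finitely many lengths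
    occurring in [u] matter. This turns the sum over all [k] of a box product into one linear
    extension. *)
Lemma fsum_lext_graded (B : ibasisType) (V : lmodType 'F_2) (len : B -> nat)
  (G : B -> V) u :
  \sum_(k \in [set: nat]) lext (fun b => if k == len b then G b else 0) u = lext G u.
Proof.
pose X := [fset len b | b in msupp u]%fset.
rewrite (fsbigTE X) => [|k kX]; last first.
  rewrite /lext big_seq big1 // => b bu; case: eqP => [kE|]; last by rewrite scaler0.
  by case/negP: kX; rewrite kE in_imfset.
rewrite exchange_big /= /lext; apply: eq_big_seq => b bu.
rewrite (big_fsetD1 (len b)) /= ?in_imfset // eqxx big1_fset ?addr0 //.
by move=> k; rewrite !inE => /andP[/negPf -> _] _; rewrite scaler0.
Qed.

Lemma fsbig_sub1 (T : choiceType) (V : zmodType) (A : set T) (F : T -> V) t :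
  A t -> (forall s, A s -> s <> t -> F s = 0) -> \sum_(s \in A) F s = F t.
Proof.
move=> At F0; rewrite -[RHS](fsbig_set1 +%R t F).
apply/esym/fsbig_widen => [s -> //|s [As sn]]; exact: F0 As sn.
Qed.

Lemma chain_rcons v ss s : chain v (rcons ss s) = alpha s (H_map (chain v ss)).
Proof. by rewrite /chain foldl_rcons. Qed.
Lemma lefts_rcons ss s :
  lefts (rcons ss s) = lefts ss ++ (if s is StepL a then [:: a] else [::]).
Proof. by rewrite /lefts -cats1 pmap_cat; case: s. Qed.
Lemma rights_rcons ss s :
  rights (rcons ss s) = rights ss ++ (if s is StepR b then [:: b] else [::]).
Proof. by rewrite /rights -cats1 pmap_cat; case: s. Qed.

(** Induction from the last step: if it is alpha or a left input, the coefficient of 1^* vanishes by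
    [eval1_alpha0_H] or [eval1_H]; if it is a right input, [eval_gen_H] turns it into one
    peeling. *)
Lemma eval1_chain_path v ss p : rights ss = path_b p ->
  eval 1 (chain v ss) = if ss == map StepR (path_b p) then foldl (fun u g =>
    peel g u) (eval 1 v) p else 0.
Proof.
elim/last_ind: ss p => [|ss s IHss] p; first by case: p.
rewrite chain_rcons rights_rcons; case: s => [|a|b].
- rewrite eval1_alpha0_H cats0 => rp; case: eqP => // E.
  have := congr1 (fun t => Step0 \in t) E.
  rewrite mem_rcons mem_head => /esym/mapP[b _ //].
- rewrite /= eval_m110 eval1_H mulr0 cats0 => rp; case: eqP => // E.
  have := congr1 (fun t => StepL a \in t) E.
  by rewrite mem_rcons mem_head => /esym/mapP[b _ //].
case/lastP: p => [|p g]; first by rewrite cats1; case: (rights ss).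
rewrite cats1 /path_b !map_rcons => /rcons_inj[rp ->]; rewrite eqseq_rcons eqxx andbT.
rewrite /= eval_m011 eval_gen_H (IHss _ rp) foldl_rcons -/(path_b p).
by case: eqP => // _; exact: flin0 (peel_flin g).
Qed.

Lemma I_mapE x : I_map (iunit x) = Kone x \|* Some (Done x).
Proof. by rewrite /I_map /iunit lext_mon. Qed.

Lemma ridem_Kone e : ridem (Kone e) = e. Proof. exact: (Kone_idem e).2. Qed.

Lemma alpha0_I x : alpha Step0 (I_map (iunit x)) = 0.
Proof.
rewrite I_mapE; case: x => /=.
  by rewrite -(alpha0_word1_nil 0 0 false) (word1_Some false (isT : alternating [::])).
by rewrite -(alpha0_word0_nil 0 false) (word0_Some false (isT : alternating [::])).
Qed.

Lemma gen_b_neq1 g e : (Done e == gen_b g) = false.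
Proof.
case: g => [l|[]|c|l]; case: e => //=; apply/eqP; case=> //.
Qed.

(** After the first step only right inputs survive, by [eval1_chain_path]. A first alpha kills
    1|1^*, and a first right generator makes the coefficient of 1^* zero, which peeling preserves;
    hence the first step is the one left input. *)
Lemma trace_path_b aa x p : trace aa x (path_b p) =
  if aa is [:: a] then eps (foldl (fun u g => peel g u) (a * mon (Kone x)) p) else 0.
Proof.
have T0 ss : trace_index aa (path_b p) ss -> (if aa is [:: a]
  then ss <> StepL a :: map StepR (path_b p) else True) ->
    trace_term x ss = 0.
  case: ss => [[]|s ss [_ la rb] ne] //; rewrite /trace_term composition_cons Pi_eval.
  rewrite lefts_cons in la; rewrite rights_cons in rb.
  case: s la rb ne => [|a|b] la rb ne.
  - by rewrite alpha0_I chain0 (flin0 (eval_flin _)) (flin0 eps_flin).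
  - rewrite (eval1_chain_path _ rb); case: eqP => [E|];
    last by rewrite (flin0 eps_flin).
    have l0 : lefts ss = [::] by rewrite E; elim: (path_b p).
    by move: ne; rewrite -la l0 /= E.
  case: p rb {ne la} => [//|g p [bE rb]].
  rewrite (eval1_chain_path _ rb) /= eval_m011 I_mapE bE eval_tens_ostar.
  have -> : (Some (Done x) == Some (gen_b g)) = false by apply: gen_b_neq1.
  rewrite andbF scale0r; case: eqP => // _; last by rewrite (flin0 eps_flin).
  elim: p {rb} => [|g' p IHp] /=; first by rewrite (flin0 eps_flin).
  by rewrite (flin0 (peel_flin g')).
case: aa T0 => [|a [|a' aa]] T0.
- by apply: fsbig1 => ss iss; apply: T0.
- rewrite /trace (fsbig_sub1 (t := StepL a :: map StepR (path_b p))).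
  + rewrite /trace_term composition_cons Pi_eval.
    rewrite (@eval1_chain_path _ _ p) ?eqxx; last by elim: (path_b p) => //= b q ->.
    by rewrite I_mapE eval_m110 eval_mon ?ridem_Kone ?ridem_Done // coef1_Kd;
      case: (x); rewrite eqxx ?orbT scale1r.
  + split=> //; rewrite ?lefts_cons ?rights_cons /=; elim: (path_b p) => //= b q IHq.
      by rewrite IHq.
  + by move=> ss iss; apply: T0.
- by apply: fsbig1 => ss iss; apply: T0.
Qed.

(** * The product of the trace with the cotrace *)

(** The number of generators peeled off: from W^i Z^j first |i - j| letters, then min(i, j) factors
    U; from U^k T^j first |j| letters, then k factors U; one more for sigma or tau. *)
Definition lenK (a : Kmon) : nat :=
  match a with
  | KWZ i j => maxn i j | KUT k j => k + `|j| | KUTs _ k j => (k + `|j|).+1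
  end.

Lemma peel_mon_spec g m m' : peel_mon g m = Some m' ->
  [/\ ridem m' = gen_tgt g, Kmul m' (gen_c g) = Some m & lenK m = (lenK m').+1].
Proof.
case: g => [l|[]|c|l]; case: m => [i j|k j|c' k j] //=.
- case: l; case: ifP => // lt [<-]; split=> //=.
  + by congr (Some (KWZ _ _)); lia.
  + by lia.
  + by congr (Some (KWZ _ _)); lia.
  + by lia.
- case: ifP => // /andP[/eqP -> k0] [<-]; split=> //=; last by lia.
  by congr (Some (KUT _ _)); lia.
- case: ifP => // /andP[/eqP -> k0] [<-]; split=> //=; last by lia.
  by congr (Some (KWZ _ _)); lia.
- by case: eqP => // <- [<-]; split=> //=; rewrite addn0 addr0.
- case: l; case: ifP => // lt [<-]; split=> //=.
  + by congr (Some (KUT _ _)); lia.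
  + by lia.
  + by congr (Some (KUT _ _)); lia.
  + by lia.
Qed.

(** The conditions j < i, i < j and i = j > 0 on W^i Z^j, and j > 0, j < 0 and j = 0 < k on U^k T^j,
    exclude each other and miss only the unit; sigma or tau determines the generator by itself. *)
Lemma count_peel_mon m : count (fun g =>
  peel_mon g m) (gens (ridem m)) = (0 < lenK m)%N.
Proof.
case: m => [i j|k j|[] k j] //=.
- case: (ltngtP i j) => //= [||_]; [by case: j | by case: i | by case: i].
- by do 3![case: ifP => /= ?]; lia.
Qed.

(** The contribution of a path to the box product, with [r] accumulating the generators already
    peeled off so that one can recurse on the first generator. *)
Definition AADD_path (p : seq gen) (x : idem) (r u : K) : span (tbasis idem Kmon) :=
  tens (eps (foldl (fun u g => peel g u) u p) * iunit (path_tgt x p))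
    ((\prod_(c <- rev (path_c p)) c) * r).

Lemma foldl_peel_flin p : flin (fun u => foldl (fun u g => peel g u) u p).
Proof. by elim: p => [|g p IHp] /=;
  [exact: flin_id|exact: flin_comp IHp (peel_flin g)]. Qed.

Lemma AADD_path_flin p x r : flin (AADD_path p x r).
Proof.
have h : flin (fun u => eps (foldl (fun u g => peel g u) u p) * iunit (path_tgt x p)).
  by apply: flin_comp (flin_mulr _) _; apply: flin_comp eps_flin (foldl_peel_flin p).
exact: flin_comp (tens_flinl _) h.
Qed.

Lemma AADD_path_cons g p x r m : AADD_path (g :: p) x r (mon m) =
  if peel_mon g m is Some m' then AADD_path p (gen_tgt g) (mon (gen_c g) * r)
    (mon m') else 0.
Proof.
have -> : AADD_path (g :: p) x r (mon m) = AADD_path p (gen_tgt g) (mon (gen_c g)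
  * r) (peel g (mon m)).
  by rewrite /AADD_path /= rev_cons -cats1 big_cat /= big_seq1 mulrA.
rewrite /peel lext_mon; case: (peel_mon g m) => //=;
  exact: flin0 (AADD_path_flin _ _ _).
Qed.

Lemma AADD_path_size p x r m : AADD_path p x r (mon m) != 0 -> size p = lenK m.
Proof.
elim: p x r m => [|g p IHp] x r m.
  rewrite /AADD_path /= /eps lext_mon.
  have [->|_] := eqVneq m (Kone false); first by [].
  have [->|_] := eqVneq m (Kone true); first by [].
  by rewrite mul0r tens0l eqxx.
rewrite AADD_path_cons; case E: (peel_mon g m) => [m'|]; last by rewrite eqxx.
by have [_ _ ->] := peel_mon_spec E; move/IHp => /= ->.
Qed.

Lemma lenK0 m : lenK m = 0%N -> m = Kone (ridem m).
Proof.
case: m => [i j|k j|c k j] //= h.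
  by have [-> ->] : i = 0%N /\ j = 0%N by lia.
by have [-> ->] : k = 0%N /\ j = 0 by lia.
Qed.

Lemma iunit_tens (x : idem) (r : K) : tens (iunit x) r = tens (1 : Iring)
  (mon (Kone x) * r).
Proof.
apply: (span_ext (f := fun r => tens (iunit x) r)
   (g := fun r : K => tens (1 : Iring) (mon (Kone x) * r))) => [||a].
- exact: tens_flinr.
- exact: flin_comp (tens_flinr _) (flin_mull _).
rewrite mul_mon -[Kone x]/(pone x) pmul1l.
rewrite [1 : Iring]/(mon (false : idem) + mon (true : idem)) (flinD (tens_flinl _)).
case: eqP => [xa|xa] /=; last by rewrite !tens0r addr0 tens_mon_neq //; apply/eqP.
have n0 : tens (mon (~~ x : idem)) (mon a) = 0.
  by apply: tens_mon_neq; rewrite -xa /=; case: (x).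
by rewrite /iunit; case: x n0 {xa} => /= ->; rewrite ?addr0 ?add0r.
Qed.

Lemma sum_AADD_path k m r : \sum_(p <- paths k (ridem m)) AADD_path p (ridem m)
  r (mon m) =
  if k == lenK m then tens (1 : Iring) (mon m * r) else 0.
Proof.
have [kE|kn] := eqVneq k (lenK m); last first.
  rewrite big_seq big1 // => p /size_paths pk.
  by apply/eqP; apply: contraTT kn => /AADD_path_size; rewrite pk negbK => ->.
elim: k m r kE => [|k IHk] m r kE.
  rewrite big_seq1 /AADD_path /= big_nil mul1r /path_tgt /=.
  rewrite [in mon m](lenK0 (esym kE)) [in RHS](lenK0 (esym kE)) -iunit_tens.
  congr (tens _ r); rewrite /eps lext_mon /iunit.
  by case: (ridem m) => /=; rewrite mul_mon.
rewrite sum_pathsS.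
(* What is peeled off [m] is restored in the accumulator, so every possible first generator would
   give the same value and only their number, which is 1, matters. *)
rewrite (eq_bigr (fun g => if peel_mon g m then tens (1 : Iring) (mon m * r)
  else 0)); last first.
  move=> g _; under eq_bigr do rewrite AADD_path_cons.
  case E: (peel_mon g m) => [m'|] /=; last by rewrite big1.
  have [m'g mul lm] := peel_mon_spec E.
  rewrite -m'g IHk; last by move: kE; rewrite lm => -[].
  by rewrite mulrA mul_mon -[pmul m' _]/(Kmul m' (gen_c g)) mul.
rewrite -big_mkcond big_const_seq count_peel_mon -kE.
by rewrite /= addr0.
Qed.

Lemma box_AADD_termE aa x p : box_AADD_term trace aa x (path_b p, path_tgt x p,
  path_c p) =
  if aa is [:: a] then AADD_path p x 1 (a * mon (Kone x)) else 0.
Proof.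
rewrite /box_AADD_term /= trace_path_b /AADD_path mulr1.
by case: aa => [|a []] *; rewrite ?mul0r ?tens0l.
Qed.

Lemma mulr_Kone (V : lmodType 'F_2) (f : K -> V) x (a : K) : flin f ->
  f (a * mon (Kone x)) = lext (fun m => if ridem m == x then f (mon m) else 0) a.
Proof.
move=> hf; apply: (span_ext (f := fun a : K => f (a * mon (Kone x)))) => [||m].
- exact: flin_comp hf (flin_mulr _).
- exact: flin_lext.
rewrite lext_mon mul_mon -[Kone x]/(pone x) pmulr1.
by case: ifP => //= _; rewrite (flin0 hf).
Qed.

Lemma box_AADD_finite aa x : box_finite cotrace x (box_AADD_term trace aa x).
Proof.
(* For any other number of left inputs every term vanishes, just as for the single input 0. *)
pose a : K := if aa is [:: a] then a else 0.
apply: (sub_finite_set _ (finite_seq [seq lenK m | m <- msupp a])) => k [t].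
rewrite iterDD_cotrace => /mapP[p /size_paths pk ->]; rewrite box_AADD_termE.
rewrite (_ : (if aa is [:: a] then _ else 0) = AADD_path p x 1 (a * mon (Kone x)));
  last first.
  by rewrite /a; case: (aa) => [|b []] *;
    rewrite // mul0r (flin0 (AADD_path_flin _ _ _)).
rewrite (mulr_Kone _ _ (AADD_path_flin p x 1)) => nz.
change (is_true (k \in [seq lenK m | m <- msupp a])); apply: contraNT nz => kn.
apply/eqP; rewrite /lext big_seq big1 // => m ma; case: eqP => [_|];
  last by rewrite scaler0.
have [->|/AADD_path_size pm] := eqVneq (AADD_path p x 1 (mon m)) 0;
  first by rewrite scaler0.
by case/mapP: kn; exists m => //; rewrite -pk.
Qed.

Lemma box_AADD_id aa x : box_AADD trace cotrace aa x = id_K aa x.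
Proof.
rewrite /box_AADD.
have E k : \sum_(t <- iterDD cotrace k x) box_AADD_term trace aa x t =
    \sum_(p <- paths k x) if aa is [:: a]
      then AADD_path p x 1 (a * mon (Kone x)) else 0.
  by rewrite iterDD_cotrace big_map; apply: eq_bigr => p _; exact: box_AADD_termE.
etransitivity; first by apply: eq_fsbigr => k _; exact: E.
case: aa {E} => [|a [|a' aa]]; [by apply: fsbig1 => k _; rewrite big1| |
  by apply: fsbig1 => k _; rewrite big1].
pose G (m : Kmon) : span (tbasis idem Kmon) :=
  if ridem m == x then tens (1 : Iring) (mon m : K) else 0.
have E' k : \sum_(p <- paths k x) AADD_path p x 1 (a * mon (Kone x)) =
           lext (fun m => if k == lenK m then G m else 0) a.
  apply: (span_ext (f := fun a : K =>
    \sum_(p <- paths k x) AADD_path p x 1 (a * mon (Kone x)))) => [||m].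
  - move=> c u v; rewrite scaler_sumr -big_split; apply: eq_bigr => p _ /=.
    by rewrite mulrDl -scalerAl AADD_path_flin.
  - exact: flin_lext.
  under eq_bigr do rewrite (mulr_Kone _ _ (AADD_path_flin _ _ _)) lext_mon.
  rewrite lext_mon /G; case: eqP => [<-|_]; last by rewrite if_same big1.
  by rewrite sum_AADD_path mulr1.
etransitivity; first by apply: eq_fsbigr => k _; exact: E'.
rewrite fsum_lext_graded /G /=.
by rewrite (mulr_Kone _ _ (tens_flinr _)).
Qed.

(** * The product of the cotrace with the trace *)

(** Each component of H needs a positive power of W, Z or U, a nonzero power of T, or a sigma or tau
    in the coefficient. *)
Lemma H_Kone e xi : H_map (mon (Kone e) \| xi) = 0.
Proof.
apply: (span_ext (f := fun xi => H_map (mon (Kone e) \| xi)) (g := fun=> 0)) => [||y].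
- exact: flin_comp H_flin (tens_flinr _).
- exact: flin_cst0.
have [h|h] := eqVneq (ridem (Kone e)) (ridem (y : Dmon)); last first.
  by rewrite tens_mon_neq // H_map0.
rewrite [LHS](H_tens h); case: e y {h} => [] [u f|u f|c p f] //=.
  by rewrite !andbF !addr0.
by rewrite !andbF !addr0.
Qed.

Lemma Hstep0_Kone y : Hstep0 (Kone (ridem y) \|* Some y) = 0.
Proof.
case: y => [[u ua] e|[u ua] e|c p e].
- rewrite -[Some _]/(Some (D0 (Sub u ua) e)) -(word0_Some e ua) /=.
  case/lastP: u ua => [|v l] ua; first by rewrite /Hstep0 alpha0_word0_nil H_map0.
  (* Both exponents are 0, so the inequality holds for either last letter; a remaining 1|theta^* is
     killed by [H_Kone]. *)
  rewrite Hstep0_word0_rcons; last by case: (l).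
  by case: ifP => // _; exact: (H_Kone false).
- rewrite -[Some _]/(Some (D1 (Sub u ua) e)) -(word1_Some e ua) /= /Hstep0.
  case/lastP: u ua => [|v l] ua; first by rewrite alpha0_word1_nil H_map0.
  by rewrite alpha0_word1_rcons ?H_map0 //; case: (l).
- exact: Hstep0_KUT_isDS.
Qed.

Lemma m011_Kone b e xi : exists xi', m011 (mon (Kone e) \| xi) b = mon (Kone e) \| xi'.
Proof.
elim/span_ind: xi => [|c u v [u' IHu] [v' IHv]|y].
- by exists 0; rewrite !tens0r (flin0 (m011_flin b)).
- by exists (c *: u' + v'); rewrite !tens_flinr (m011_flin b) IHu IHv.
have [h|h] := eqVneq (ridem (Kone e)) (ridem (y : Dmon)); last first.
  by exists 0; rewrite tens_mon_neq // tens0r (flin0 (m011_flin b)).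
by exists (dual_mulr y b); rewrite /m011 [LHS](Lext_tens _ h).
Qed.

(* The y' such that c_g (1|y^* ) is sent by H to 1|y'^*. Among the factorizations
   y' = y b_g only one is selected: theta comes first, and s, t come last, so that
   zs is reached as z.s and not as s.phi_+. *)
Definition push (y : Dmon) (g : gen) : option Dmon :=
  match g, y with
  | Glet0 l, D0 u e => word0 (rcons (val u) l) e
  | Glet1 l, D1 u e => word1 (rcons (val u) l) e
  | Gtheta false, D0 u e => if (val u == [::]) && ~~ e then word0 [::] true else None
  | Gtheta true, D1 u e => if (val u == [::]) && ~~ e then word1 [::] true else None
  | Gbridge c, D0 u e => wordS c (val u) e
  | _, _ => None
  end.

Definition gen_src (g : gen) : idem := ridem (gen_c g).

Lemma push_mul y g y' : push y g = Some y' -> Dmul y (gen_b g) = Some y'.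
Proof.
case: g => [l|[]|c|l]; case: y => [u e|u e|d p e] //=;
  rewrite ?andbF ?orbF ?orbT ?andbT ?cats0 ?cats1 //.
- by case: eqP => //= ->; case: e.
- by case: eqP => //= ->; case: e.
Qed.

(** The product must not vanish: if [y] ends in w, then H sends sigma|y^* to T^-1 sigma|(yz)^*, a
    case excluded by ws = 0; tau and zt = 0 are symmetric. *)
Lemma H_gen_c y g : gen_src g = ridem y -> Dmul y (gen_b g) ->
  H_map (gen_c g \|* Some y) = Kone (gen_tgt g) \|* push y g.
Proof.
have if0 (b : bool) (o : option Dmon) (a : Kmon) :
    (if b then a \|* o else 0) = a \|* (if b then o else None).
  by case: b; rewrite // ostarN.
move=> gy; rewrite H_tens //; case: g gy => [l|[]|c|l]; case: y => [u e|u e|d p e] //=;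
  rewrite /gen_src /= => gy; rewrite ?ostarN //.
- by case: l gy => /= _ _; rewrite ?andbF ?addr0 ?add0r.
- by rewrite -[(0 < 1)%N]/true !add0r !andbT if0.
- by rewrite -[(0 < 1)%N]/true !add0r !andbT if0.
- rewrite andbF orbF cats0 /wordS; have [-> _|_] := eqVneq (sval u) [::].
    by rewrite /= addr0.
  have [-> _|//] := eqVneq (sval u) [:: c]; rewrite (_ : ends_in _ _ = false) ?addr0 //.
  by case: (c).
- by case: l gy => /= _ _; rewrite ?andbF ?addr0 ?add0r.
Qed.

Definition push_path (x : idem) (p : seq gen) : option Dmon :=
  foldl (fun o g => obind (push^~ g) o) (Some (Done x)) p.
Lemma push_path_rcons x p g : push_path x (rcons p g) = obind (push^~ g)
  (push_path x p).
Proof. by rewrite /push_path foldl_rcons. Qed.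

Lemma ridem_gen_b g : ridem (gen_b g) = gen_tgt g.
Proof. by case: g => [l|[]|c|l]. Qed.
Lemma lidem_gen_b g : lidem (gen_b g) = gen_src g.
Proof. by case: g => [[]|[]|c|[]]. Qed.

Lemma rcons_paths k x p g : rcons p g \in paths k.+1 x -> p \in paths k x /\ g \in
  gens (path_tgt x p).
Proof.
by move=> /= /allpairsPdep[q [h [qk hq /rcons_inj[-> ->]]]].
Qed.

Lemma gens_src g e : g \in gens e -> gen_src g = e.
Proof. by case: e; rewrite !inE /gen_src; do ?[case/predU1P => [->//|]];
  move/eqP=> ->. Qed.

(* In contrast with [chain], H is applied after each alpha. *)
Definition Hchain (v : L) (ss : seq step) : L := foldl (fun v s =>
  H_map (alpha s v)) v ss.
Lemma Hchain_rcons v ss s : Hchain v (rcons ss s) = H_map (alpha s (Hchain v ss)).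
Proof. by rewrite /Hchain foldl_rcons. Qed.

Lemma Hchain_cons s v ss : Hchain v (s :: ss) = H_map (chain (alpha s v) ss).
Proof.
by rewrite /=; elim: ss (alpha s v) => //= t ss IHss w; rewrite IHss.
Qed.

Lemma composition_rcons ss s x :
  composition (rcons ss s) x = Pi_map (alpha s (Hchain (I_map x) ss)).
Proof. by case: ss => [//|t ss]; rewrite Hchain_cons composition_cons chain_rcons. Qed.

(** The final idempotent matters for the empty path, whose product would otherwise be i_0 + i_1. *)
Definition path_prod (x : idem) (p : seq gen) : Kd :=
  (\prod_(b <- path_b p) b) * mon (Done (path_tgt x p)).

Lemma path_prod_rcons x k p g : rcons p g \in paths k.+1 x ->
  path_prod x (rcons p g) = path_prod x p * mon (gen_b g).
Proof.
case/rcons_paths => _ /gens_src gsg;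
  rewrite /path_prod /path_b map_rcons -cats1 big_cat /= big_seq1.
rewrite path_tgt_rcons -!mulrA !mul_mon -[Done _]/(pone _)
  -[Done (path_tgt _ _)]/(pone _).
by rewrite pmulr1 pmul1l lidem_gen_b ridem_gen_b gsg !eqxx.
Qed.

Lemma push_path_prod k x p y : p \in paths k x -> push_path x p = Some y ->
  path_prod x p = mon y /\ (lidem y = x /\ ridem y = path_tgt x p).
Proof.
elim: k p y => [|k IHk] p y.
  rewrite inE => /eqP -> [<-]; rewrite /path_prod big_nil mul1r; split=> //.
  exact: Done_idem.
case/lastP: p => [|p g] pk; first by have := size_paths pk.
rewrite push_path_rcons (path_prod_rcons pk); have [pk' _] := rcons_paths pk.
case E: (push_path x p) => [y0|] //= /push_mul mul.
have [-> [l0 r0]] := IHk _ _ pk' E.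
have [_ l2 r2] := pmul_idem (y0 : Dmon) (gen_b g : Dmon) y mul.
by rewrite mul_mon [pmul y0 _]mul path_tgt_rcons l2 r2 ridem_gen_b.
Qed.

(** A nonzero product has nonzero initial products, so [H_gen_c] applies at every step. *)
Lemma Hchain_path k x p : p \in paths k x -> path_prod x p != 0 ->
  Hchain (I_map (iunit x)) (map StepL (path_c p)) =
  if push_path x p is Some y then Kone (path_tgt x p) \|* Some y else 0.
Proof.
elim: k p => [|k IHk] p.
  by rewrite inE => /eqP -> _; rewrite /= I_mapE.
case/lastP: p => [|p g] pk; first by have := size_paths pk.
rewrite (path_prod_rcons pk) /path_c !map_rcons -/(path_c p)
  Hchain_rcons push_path_rcons => nz.
have [pk' /gens_src gsg] := rcons_paths pk.
rewrite IHk //; last by apply: contraNN nz => /eqP ->; rewrite mul0r.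
case E: (push_path x p) => [y|] /=; last by rewrite (flin0 (m110_flin _)) H_map0.
have [py [_ ry]] := push_path_prod pk' E; rewrite py mul_mon in nz.
rewrite m110_tens mul_mon -[Kone _]/(pone _) pmulr1 -/(gen_src g) gsg eqxx /=.
rewrite path_tgt_rcons H_gen_c ?gsg ?ry //; last first.
  by move: nz; rewrite -[pmul y _]/(Dmul y (gen_b g));
    case: (Dmul y (gen_b g)) => //=; rewrite eqxx.
by case: (push y g) => //; rewrite ostarN.
Qed.

(** Before the first deviation from left inputs the state is 0 or 1|y^*. There alpha followed by H
    gives 0 by [Hstep0_Kone], and a right input keeps the coefficient 1, which [H_Kone] kills. *)
Lemma Hchain_other k x p ss : p \in paths k x -> path_prod x p != 0 ->
  lefts ss = path_c p -> ss <> map StepL (path_c p) -> Hchain (I_map (iunit x)) ss = 0.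
Proof.
elim/last_ind: ss k p => [|ss s IHss] k p pk nz; first by move=> /= <-.
have kills (s' : step) : (forall e y,
  ridem y = e -> H_map (alpha s' (Kone e \|* Some y)) = 0) ->
    lefts ss = path_c p -> H_map (alpha s' (Hchain (I_map (iunit x)) ss)) = 0.
  move=> ks lp; have [E|/eqP ne] := eqVneq ss (map StepL (path_c p)); last first.
    by rewrite (IHss _ _ pk nz lp ne) (flin0 (alpha_flin _)) H_map0.
  rewrite E (Hchain_path pk nz); case E2: (push_path x p) => [y|].
    by apply: ks; have [_ [_ ->]] := push_path_prod pk E2.
  by rewrite (flin0 (alpha_flin _)) H_map0.
rewrite lefts_rcons Hchain_rcons; case: s => [|a|b]; rewrite ?cats0 => lp ne.
- by apply: kills => // e y <-; exact: Hstep0_Kone.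
- case: k pk => [|k]; first by rewrite inE => /eqP pE; move: lp;
  rewrite pE /path_c /= cats1; case: (lefts ss).
  case/lastP: p nz lp ne {kills} => [|p g] nz lp ne pk; first by have := size_paths pk.
  have [pk' _] := rcons_paths pk; move: lp ne;
    rewrite /path_c !map_rcons -/(path_c p) cats1.
  case/rcons_inj => lp ->; move=> ne;
    rewrite (IHss _ _ pk' _ lp) ?(flin0 (alpha_flin _)) ?H_map0 //.
    by apply: contraNN nz => /eqP z; rewrite (path_prod_rcons pk) z mul0r.
  by move=> E; apply: ne; rewrite E.
- apply: kills => // e y ye /=.
  by have [xi ->] := m011_Kone b e (ostar (Some y)); exact: H_Kone.
Qed.

Lemma eval1_Hchain x ss : ss <> [::] -> eval 1 (Hchain (I_map (iunit x)) ss) = 0.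
Proof. by case: ss => // s ss _; rewrite Hchain_cons eval1_H. Qed.

Lemma eval1_alpha0_Hchain x ss : eval 1 (alpha Step0 (Hchain (I_map (iunit x)) ss)) = 0.
Proof.
case: ss => [|s ss]; first by rewrite alpha0_I (flin0 (eval_flin _)).
by rewrite Hchain_cons eval1_alpha0_H.
Qed.

Lemma eps_gen_c g x : eps (mon (gen_c g) * mon (Kone x)) = 0.
Proof.
rewrite mul_mon -[Kone x]/(pone x) pmulr1; case: eqP => _ /=;
  last exact: flin0 eps_flin.
by rewrite /eps lext_mon; case: g => [[]|[]|c|[]].
Qed.

Lemma trace_path_c k x p bb : p \in paths k x -> path_prod x p != 0 -> trace (path_c
  p) x bb =
  if bb is [:: b] then
    if push_path x p is Some y then b@_y *: iunit (path_tgt x p) else 0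
  else 0.
Proof.
move=> pk nz.
have T0 ss : trace_index (path_c p) bb ss ->
    (if bb is [:: b] then ss <> rcons (map StepL (path_c p)) (StepR b) else True) ->
    trace_term x ss = 0.
  case/lastP: ss => [[]|ss s [_ la rb] ne] //.
  rewrite /trace_term composition_rcons Pi_eval.
  rewrite lefts_rcons in la; rewrite rights_rcons in rb.
  case: s la rb ne => [|a|b] la rb ne.
  - by rewrite eval1_alpha0_Hchain (flin0 eps_flin).
  (* A final left input after any other step acts on an image of H, which has no 1^* component; as
     the only step it yields a coefficient c_g, which [eps] kills. *)
  - rewrite eval_m110; have [ss0|/eqP ssn] := eqVneq ss [::]; last first.
      by rewrite eval1_Hchain // mulr0 (flin0 eps_flin).
    move: la; rewrite ss0 /=; case: (p) => [|g [|]] // [->].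
    rewrite I_mapE eval_mon ?ridem_Kone ?ridem_Done // coef1_Kd.
    by case: (x); rewrite eqxx ?orbT scale1r eps_gen_c.
  rewrite cats0 in la; have [E|/eqP nE] := eqVneq ss (map StepL (path_c p)); last first.
    by rewrite (Hchain_other pk nz la nE) (flin0 (alpha_flin _))
      (flin0 (eval_flin _)) (flin0 eps_flin).
  have r0 : rights ss = [::] by rewrite E; elim: (path_c p).
  by move: ne; rewrite -rb r0 /= E.
case: bb T0 => [|b [|b' bb]] T0; try by apply: fsbig1 => ss iss; apply: T0.
rewrite /trace (fsbig_sub1 (t := rcons (map StepL (path_c p)) (StepR b))).
- rewrite /trace_term composition_rcons Pi_eval /= eval_m011 (Hchain_path pk nz).
  case E: (push_path x p) => [y|];
    last by rewrite (flin0 (eval_flin _)) (flin0 eps_flin).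
  have [_ [_ ry]] := push_path_prod pk E.
  rewrite eval_mon ?ridem_Kone ?ry // (flinZ eps_flin) /eps lext_mon; congr (_ *: _).
  by case: (path_tgt x p).
- split; first by case: (map _ _).
    by rewrite lefts_rcons cats0; elim: (path_c p) => //= c q ->.
  by rewrite rights_rcons; elim: (path_c p).
- by move=> ss iss; apply: T0.
Qed.

(** * Unique factorization of the monomials of K^! *)

Definition lenD (y : Dmon) : nat :=
  match y with D0 u e | D1 u e => size (val u) + e | DS _ p e => (p + e).+1 end.

(** The inverse of [push]: s and t are removed first, then letters, and theta only once no letter is
    left. *)
Definition pop (y : Dmon) : option (Dmon * gen) :=
  match y with
  | D0 u e => if unrcons (val u) is Some (v, l) then omap (fun y0 =>
    (y0, Glet0 l)) (word0 v e)
              else if e then Some (Done false, Gtheta false) else None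
  | D1 u e => if unrcons (val u) is Some (v, l) then omap (fun y0 =>
    (y0, Glet1 l)) (word1 v e)
              else if e then Some (Done true, Gtheta true) else None
  | DS c p e => omap (fun y0 => (y0, Gbridge c)) (word0 (nseq p c) e)
  end.

Lemma Glet0_eq l l' : (Glet0 l == Glet0 l') = (l == l').
Proof. by case: l l' => [] []. Qed.
Lemma Glet1_eq l l' : (Glet1 l == Glet1 l') = (l == l').
Proof. by case: l l' => [] []. Qed.
Lemma Gbridge_eq l l' : (Gbridge l == Gbridge l') = (l == l').
Proof. by case: l l' => [] []. Qed.

Lemma push_pop y0 g y : (push y0 g == Some y) = (pop y == Some (y0, g)).
Proof.
have omE (o : option Dmon) g' : (omap (fun y0 =>
  (y0, g')) o == Some (y0, g)) = (o == Some y0) && (g' == g).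
  by case: o.
have thE (e : bool) (d : Dmon) g' : ((if e then Some (d, g') else None) == Some (y0,
  g)) =
    [&& e, Some d == Some y0 & g' == g] by case: e.
case: y => [[u ua] e|[u ua] e|c p e] /=; first case: unrconsP => [uE|v l uE];
  last 2 first.
1: case: unrconsP => [uE|v l uE].
all: rewrite ?omE ?thE; case: g {omE thE} => [l'|[]|c'|l'];
  case: y0 => [[w wa] f|[w wa] f|d q f] //=; rewrite ?andbF //.
all: rewrite ?if_Some ?word0_eq ?word1_eq ?wordS_eq ?D0_eq ?D1_eq /=.
all: try (rewrite word0_eqF //); try (rewrite word1_eqF //); try (rewrite wordS_eqF //).
all: rewrite ?andbF ?Glet0_eq ?Glet1_eq ?Gbridge_eq ?uE ?rcons_nil ?eqseq_rcons //.
- by rewrite !eqxx ![_ == w]eq_sym; case: e f (w == [::]) => [] [] [].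
- by case: (v); rewrite /= ?andbF.
- by rewrite [v == w]eq_sym [e == f]eq_sym [l == l']eq_sym andbAC.
- by rewrite [_ == w]eq_sym [e == f]eq_sym [c == c']eq_sym andbC.
- by rewrite !eqxx ![_ == w]eq_sym; case: e f (w == [::]) => [] [] [].
- by rewrite [v == w]eq_sym [e == f]eq_sym [l == l']eq_sym andbAC.
- by case: (v); rewrite /= ?andbF.
Qed.

Lemma pop_spec y y0 g : pop y = Some (y0, g) ->
  [/\ lenD y = (lenD y0).+1, lidem y = lidem y0 & ridem y0 = gen_src g].
Proof.
have wl v e d : word0 v e = Some d -> lenD d = (size v + e)%N /\ (lidem d = false /\
  ridem d = false).
  by rewrite /word0; case: insubP => //= w _ <- [<-].
have wl1 v e d : word1 v e = Some d -> lenD d = (size v + e)%N /\ (lidem d = true /\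
  ridem d = true).
  by rewrite /word1; case: insubP => //= w _ <- [<-].
case: y => [u e|u e|c p e] /=.
- case: unrconsP => [uE|v l uE]; last first.
    case E: (word0 v e) => [d|] //= [<- <-]; have [-> [-> ->]] := wl _ _ _ E.
    by rewrite -[val u]/(sval u) uE size_rcons addSn; case: (l).
  by case: e => // -[<- <-]; rewrite -[val u]/(sval u) uE.
- case: unrconsP => [uE|v l uE]; last first.
    case E: (word1 v e) => [d|] //= [<- <-]; have [-> [-> ->]] := wl1 _ _ _ E.
    by rewrite -[val u]/(sval u) uE size_rcons addSn; case: (l).
  by case: e => // -[<- <-]; rewrite -[val u]/(sval u) uE.
- case E: (word0 _ e) => [d|] //= [<- <-]; have [-> [-> ->]] := wl _ _ _ E.
  by rewrite size_nseq.
Qed.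

Lemma pop_None y : pop y = None -> y = Done (lidem y).
Proof.
case: y => [[u ua] e|[u ua] e|c p e] /=.
- case: unrconsP => [uE|v l uE]; first by case: e => // _; congr (D0 _ _);
  apply: val_inj.
  by rewrite word0_Some //; move: ua; rewrite uE; exact: alternating_rcons.
- case: unrconsP => [uE|v l uE]; first by case: e => // _; congr (D1 _ _);
  apply: val_inj.
  by rewrite word1_Some //; move: ua; rewrite uE; exact: alternating_rcons.
by rewrite word0_Some; case: p.
Qed.

Lemma lenD_eq0 y : (lenD y == 0%N) = (pop y == None).
Proof.
case E: (pop y) => [[y0 g]|]; first by have [-> _ _] := pop_spec E.
by rewrite (pop_None E); case: (lidem y).
Qed.

Lemma gens_uniq e : uniq (gens e). Proof. by case: e. Qed.
Lemma mem_gens g : g \in gens (gen_src g). Proof. by case: g => [[]|[]|[]|[]]. Qed.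

Lemma push_path_size k x p y : p \in paths k x -> push_path x p = Some y -> lenD y = k.
Proof.
elim: k p y => [|k IHk] p y; first by rewrite inE => /eqP -> [<-]; case: (x).
case/lastP: p => [|p g] pk; first by have := size_paths pk.
rewrite push_path_rcons; have [pk' _] := rcons_paths pk.
case E: (push_path x p) => [y0|] //= /eqP; rewrite push_pop => /eqP /pop_spec[-> _ _].
by rewrite (IHk _ _ pk' E).
Qed.

(** By [push_pop] a monomial determines the last generator and the state before it, so by induction
    exactly one path reaches it. Counting in F_2 lets the number of paths serve as a scalar. *)
Lemma sum_push_path k x y :
  \sum_(p <- paths k x) (push_path x p == Some y)%:R = ((k == lenD y)
    && (lidem y == x))%:R :> 'F_2.
Proof.
elim: k y => [|k IHk] y.
  rewrite big_seq1 [0%N == _]eq_sym lenD_eq0 /push_path /=.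
  case E: (pop y) => [[y0 g]|] /=.
    case: eqP => // -[yE]; move: E; rewrite -yE; by case: (x).
  rewrite {1}(pop_None E); case: (x) (lidem y) => [] [] //=; by rewrite !eqxx.
rewrite sum_pathsSr.
case E: (pop y) => [[y1 g1]|]; last first.
  rewrite big1 => [|p _]; last first.
    rewrite big1 // => g _; rewrite push_path_rcons; case: (push_path x p) => [y0|] //=.
    by rewrite push_pop E.
  have := lenD_eq0 y; rewrite E eqxx => /eqP ->; by [].
have [-> -> r1] := pop_spec E; rewrite eqSS -IHk big_seq [RHS]big_seq.
apply: eq_bigr => p pk; case Ep: (push_path x p) => [y0|]; last first.
  by rewrite big1 // => g _; rewrite push_path_rcons Ep.
under eq_bigr => g _ do rewrite push_path_rcons Ep [obind _ _]/= push_pop E.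
have [_ [_ rt]] := push_path_prod pk Ep.
have [y01|y01] := eqVneq (Some y0) (Some y1); last first.
  rewrite big1 // => g _; case: eqP => // -[yE]; by rewrite yE eqxx in y01.
case: y01 rt => -> rt; rewrite -rt r1 (bigD1_seq g1)
  ?mem_gens ?gens_uniq //= eqxx big1 ?addr0 // => g gg.
by case: eqP => // -[gE]; rewrite gE eqxx in gg.
Qed.

(** Since the tensor product is over I, the end idempotent of a path can be absorbed into its
    product, which becomes [path_prod]. *)
Lemma tens_Imul (r : Kd) (e : idem) (z : Iring) :
  tens r (iunit e * z) = tens (r * mon (Done e)) z.
Proof.
apply: (span_ext (f := fun r : Kd => tens r (iunit e * z))
  (g := fun r : Kd => tens (r * mon (Done e)) z)) => [||y].
- exact: tens_flinl.
- exact: flin_comp (tens_flinl _) (flin_mulr _).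
apply: (span_ext (f := fun z : Iring => tens (mon y : Kd) (iunit e * z))
  (g := fun z : Iring => tens (mon y * mon (Done e) : Kd) z)) => [||f].
- exact: flin_comp (tens_flinr _) (flin_mull _).
- exact: tens_flinr.
rewrite !mul_mon -[Done e]/(pone e) pmulr1 -[pmul e f]/(idem_mul e f) /idem_mul.
have [<-|ef] := eqVneq e f; have [ye|ye] := eqVneq (ridem y) e;
  rewrite /= ?tens0l ?tens0r //.
  by rewrite tens_mon_neq.
by rewrite tens_mon_neq // ye.
Qed.

Lemma tens_1r (y : Dmon) : tens (mon y : Kd) (1 : Iring) = tens (mon y : Kd)
  (iunit (ridem y)).
Proof.
have -> : (1 : Iring) = iunit (ridem y) + iunit (~~ ridem y).
  rewrite [1 : Iring]/(mon (false : idem) + mon (true : idem)).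
  by case: (ridem y) => //=; rewrite addrC.
rewrite (flinD (tens_flinr _)) [X in _ + X]tens_mon_neq ?addr0 //.
by case: (ridem y).
Qed.

Lemma box_DDAA_termE k x bb p : p \in paths k x ->
  box_DDAA_term trace x bb (path_b p, path_tgt x p, path_c p) =
  if bb is [:: b] then
    if push_path x p is Some y then b@_y *: tens (mon y) (1 : Iring) else 0
  else 0.
Proof.
move=> pk; rewrite /box_DDAA_term /= tens_Imul -/(path_prod x p).
(* If the product vanishes, the left factor of the tensor is 0 whatever the trace is, and
   [push_path] cannot succeed, as it would exhibit the product as a monomial. *)
have [z|nz] := eqVneq (path_prod x p) 0.
  rewrite z tens0l; case: bb => [|b []] //; case E: (push_path x p) => [y|] //.
  have [py _] := push_path_prod pk E; move: z;
    rewrite py => /(congr1 (fun u : Kd => u@_y)).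
  by rewrite coef_mon coef0 eqxx.
rewrite (trace_path_c _ pk nz); case: bb => [|b []] *; rewrite ?tens0r //.
case E: (push_path x p) => [y|]; last by rewrite tens0r.
have [-> [_ <-]] := push_path_prod pk E.
by rewrite (flinZ (tens_flinr _)) tens_1r.
Qed.

Lemma box_DDAA_finite x bb : box_finite cotrace x (box_DDAA_term trace x bb).
Proof.
pose b : Kd := if bb is [:: b] then b else 0.
apply: (sub_finite_set _ (finite_seq [seq lenD y | y <- msupp b])) => k [t].
rewrite iterDD_cotrace => /mapP[p pk ->]; rewrite (box_DDAA_termE _ pk) => nz.
change (is_true (k \in [seq lenD y | y <- msupp b])).
move: nz; rewrite /b; case: (bb) => [|c [|c' r]]; rewrite ?eqxx //.
case E: (push_path x p) => [y|] nz; last by rewrite eqxx in nz.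
apply/mapP; exists y; last by rewrite (push_path_size pk E).
by rewrite -mcoeff_neq0; apply: contraNN nz => /eqP ->; rewrite scale0r.
Qed.

Lemma mull_Done (V : lmodType 'F_2) (f : Kd -> V) x (b : Kd) : flin f ->
  f (mon (Done x) * b) = lext (fun y => if lidem y == x then f (mon y) else 0) b.
Proof.
move=> hf; apply: (span_ext (f := fun b : Kd => f (mon (Done x) * b))) => [||y].
- exact: flin_comp hf (flin_mull _).
- exact: flin_lext.
rewrite lext_mon mul_mon -[Done x]/(pone x) pmul1l eq_sym.
by case: ifP => //= _; rewrite (flin0 hf).
Qed.

Lemma box_DDAA_id x bb : box_DDAA cotrace trace x bb = id_Kd x bb.
Proof.
rewrite /box_DDAA.
have E k : \sum_(t <- iterDD cotrace k x) box_DDAA_term trace x bb t =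
    \sum_(p <- paths k x) if bb is [:: b] then
      if push_path x p is Some y then b@_y *: tens (mon y) (1 : Iring) else 0
    else 0.
  rewrite iterDD_cotrace big_map big_seq [RHS]big_seq; apply: eq_bigr => p pk.
  exact: box_DDAA_termE pk.
etransitivity; first by apply: eq_fsbigr => k _; exact: E.
case: bb {E} => [|b [|b' bb]]; [by apply: fsbig1 => k _; rewrite big1| |
  by apply: fsbig1 => k _; rewrite big1].
pose G (y : Dmon) : span (tbasis Dmon idem) :=
  if lidem y == x then tens (mon y : Kd) (1 : Iring) else 0.
have E k : \sum_(p <- paths k x)
      (if push_path x p is Some y then b@_y *: tens (mon y) (1 : Iring) else 0) =
    lext (fun y => if k == lenD y then G y else 0) b.
  apply: (span_ext (f := fun b : Kd => \sum_(p <- paths k x)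
      (if push_path x p is Some y then b@_y *: tens (mon y) (1 : Iring) else 0))) =>
        [||y].
  - move=> c u v; rewrite scaler_sumr -big_split; apply: eq_bigr => p _ /=.
    case: (push_path x p) => [y|]; last by rewrite scaler0 addr0.
    by rewrite coefD coefZ scalerDl scalerA.
  - exact: flin_lext.
  rewrite lext_mon.
  (* For a monomial input only the paths pushed to it contribute, all with the same tensor, so it
     remains to count them modulo 2. *)
  transitivity ((\sum_(p <- paths k x) (push_path x p == Some y)%:R : 'F_2) *:
                tens (mon y : Kd) (1 : Iring)).
    rewrite scaler_suml; apply: eq_bigr => p _; case: (push_path x p) => [z|];
      last by rewrite scale0r.
    rewrite coef_mon -[Some z == _]/(z == y) eq_sym.
    by case: eqP => [->|_]; rewrite ?scale0r.
  rewrite sum_push_path /G; case: eqP => _; case: eqP => _;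
    rewrite /= ?scale1r ?scale0r //.
etransitivity; first by apply: eq_fsbigr => k _; exact: E.
by rewrite fsum_lext_graded /G /= (mull_Done _ _ (tens_flinl _)).
Qed.

Theorem theorem1p3 :
  (forall (aa : seq K) (x : idem) (bb : seq Kd), trace_finite aa x bb) /\
  (forall (aa : seq K) (x : idem),
     box_finite cotrace x (box_AADD_term trace aa x)) /\
  (forall (x : idem) (bb : seq Kd),
     box_finite cotrace x (box_DDAA_term trace x bb)) /\
  (forall (aa : seq K) (x : idem), box_AADD trace cotrace aa x = id_K aa x) /\
  (forall (x : idem) (bb : seq Kd), box_DDAA cotrace trace x bb = id_Kd x bb).
Proof.
split; first exact: trace_finiteP.
split; first exact: box_AADD_finite.
split; first exact: box_DDAA_finite.
split; [exact: box_AADD_id | exact: box_DDAA_id].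
Qed.
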